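(* Let $\mathbb{F}$ be an algebraically closed field of characteristic $0$. Let $(\mathfrak{g}=\mathfrak{s}\oplus\mathfrak{r},B)$ be a non solvable and non simple irreducible quadratic Lie algebra over $\mathbb{F}$, where $\mathfrak{s}$ is a Levi subalgebra of $\mathfrak{g}$ and $\mathfrak{r}$ is the solvable radical of $\mathfrak{g}$. Assume $\mathfrak{r}\neq\mathfrak{r}^\perp$. If $\dim\mathfrak{g}\leq 13$, then: \begin{enumerate} \item $\mathfrak{s}$ is isomorphic to the simple Lie algebra $\mathfrak{sl}_2(\mathbb{F})$; \item if $\mathfrak{u}$ is an irreducible submodule of the $\mathfrak{s}(\cong\mathfrak{sl}_2(\mathbb{F}))$-module $\mathfrak{r}/\mathfrak{r}^\perp$, then $\mathfrak{u}$ is, up to isomorphism, $V(n)$ where $n\in\{0,1,2,4,6\}$. \end{enumerate}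
   Context: All Lie algebras are finite-dimensional. A Lie algebra $\mathfrak{g}$ is quadratic if it is endowed with a nondegenerate symmetric invariant bilinear form $B$ (invariant: $B([x,y],z)=B(x,[y,z])$). It is irreducible if it contains no ideal $\mathfrak{i}$ with $0\ne\mathfrak{i}\ne\mathfrak{g}$ such that $B|_{\mathfrak{i}\times\mathfrak{i}}$ is nondegenerate. $\perp$ denotes the orthogonal relative to $B$; in this situation $\mathfrak{r}^\perp\subseteq\mathfrak{r}$. $V(n)$ denotes the irreducible $\mathfrak{sl}_2(\mathbb{F})$-module of dimension $n+1$. *)

(* Defs.v *)
From HB Require Import structures.
From mathcomp Require Import all_boot all_order all_algebra.
From mathcomp Require Import generic_quotient ring zify.

Set Implicit Arguments.
Unset Strict Implicit.
Unset Printing Implicit Defensive.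

Import GRing.Theory.
Local Open Scope ring_scope.
Local Open Scope quotient_scope.

HB.mixin Record Vector_isLieAlgebra (F : fieldType) (L : Type)
    of Vector F L := {
  lie : L -> L -> L;
  lie_linearl_subproof : forall y, linear (lie^~ y);
  lie_linearr_subproof : forall x, linear (lie x);
  liexx : forall x, lie x x = 0;
  lie_jacobi : forall x y z,
    lie x (lie y z) + lie y (lie z x) + lie z (lie x y) = 0
}.

#[short(type="lieAlgType")]
HB.structure Definition LieAlgebra (F : fieldType) :=
  { L of Vector F L & Vector_isLieAlgebra F L }.

Notation "[l x , y ]" := (lie x y) (at level 0, format "[l  x ,  y ]") : ring_scope.

HB.instance Definition _ (F : fieldType) (L : lieAlgType F) :=
  bilinear_isBilinear.Build F L L L _ _ (@lie F L)
    (@lie_linearl_subproof F L, @lie_linearr_subproof F L).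

Section LieTheory.
Variables (F : fieldType) (L : lieAlgType F).
Implicit Types (x y z : L) (U V W : {vspace L}).

Lemma lieC x y : [l x, y] = - [l y, x].
Proof.
apply/eqP; rewrite -addr_eq0; apply/eqP.
have := liexx (x + y).
by rewrite linearDl /= !linearDr /= !liexx add0r addr0.
Qed.

Lemma lie_derivation x y z : [l x, [l y, z]] = [l [l x, y], z] + [l y, [l x, z]].
Proof.
have /eqP := lie_jacobi x y z.
rewrite (lieC z x) linearNr (lieC z) -addrA addr_eq0 opprD !opprK => /eqP ->.
by rewrite addrC.
Qed.

Definition lie_prodv U V : {vspace L} :=
  <<[seq [l u, v] | u <- vbasis U, v <- vbasis V]>>%VS.

Lemma mem_lie_prodv U V u v : u \in U -> v \in V -> [l u, v] \in lie_prodv U V.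
Proof.
move=> /coord_vbasis-> /coord_vbasis->.
rewrite linear_sumlz; apply: rpred_sum => i _.
rewrite linear_sumr; apply: rpred_sum => j _.
rewrite linearZl_LR linearZr_LR; do 2!apply: rpredZ.
by apply/memv_span/allpairs_f; rewrite mem_nth ?size_tuple.
Qed.

Lemma lie_prodvP U V W :
  reflect (forall u v, u \in U -> v \in V -> [l u, v] \in W)
          (lie_prodv U V <= W)%VS.
Proof.
apply: (iffP idP) => [/subvP sub u v uU vV|H].
  by apply/sub/mem_lie_prodv.
apply/span_subvP => _ /allpairsP[[u v] [/= uU vV ->]].
by apply: H; exact: vbasis_mem.
Qed.

Definition derived_series U n : {vspace L} :=
  iter n (fun W => lie_prodv W W) U.

Definition lie_solvable U : Prop := exists n, derived_series U n = 0%VS.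

Record lieSubalg := LieSubalg {
  lieSubalg_vs :> {vspace L};
  lieSubalgP : forall x y, x \in lieSubalg_vs -> y \in lieSubalg_vs ->
    [l x, y] \in lieSubalg_vs
}.

Record lieIdeal := LieIdeal {
  lieIdeal_vs :> {vspace L};
  lieIdealP : forall x y, y \in lieIdeal_vs -> [l x, y] \in lieIdeal_vs
}.

Definition is_radical (r : lieIdeal) : Prop :=
  lie_solvable r /\ forall I : lieIdeal, lie_solvable I -> (I <= r)%VS.

Definition lie_simple : Prop :=
  lie_prodv fullv fullv <> 0%VS /\
  forall I : lieIdeal, (I : {vspace L}) = 0%VS \/ (I : {vspace L}) = fullv.

Definition lie_semisimple : Prop :=
  forall I : lieIdeal, lie_solvable I -> (I : {vspace L}) = 0%VS.

End LieTheory.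

Section SubLieAlgebra.
Variables (F : fieldType) (L : lieAlgType F) (s : lieSubalg L).

Definition sub_lie (x y : subvs_of s) : subvs_of s :=
  Subvs (lieSubalgP (subvsP x) (subvsP y)).

Fact sub_lie_linearl y : linear (sub_lie^~ y).
Proof. by move=> a u v; apply/val_inj; rewrite /= linearPl. Qed.
Fact sub_lie_linearr x : linear (sub_lie x).
Proof. by move=> a u v; apply/val_inj; rewrite /= linearPr. Qed.
Fact sub_liexx x : sub_lie x x = 0.
Proof. by apply/val_inj; rewrite /= liexx. Qed.
Fact sub_lie_jacobi x y z :
  sub_lie x (sub_lie y z) + sub_lie y (sub_lie z x) + sub_lie z (sub_lie x y) = 0.
Proof. by apply/val_inj; rewrite /= lie_jacobi. Qed.

HB.instance Definition _ := Vector_isLieAlgebra.Build F (subvs_of s)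
  sub_lie_linearl sub_lie_linearr sub_liexx sub_lie_jacobi.

End SubLieAlgebra.

(* s is required to be semisimple, although this follows from g = s (+) r. *)
Definition is_levi (F : fieldType) (g : lieAlgType F)
    (s : lieSubalg g) (r : lieIdeal g) : Prop :=
  [/\ lie_semisimple (subvs_of s), (s + r = fullv)%VS & (s :&: r = 0)%VS].

Record lieHom (F : fieldType) (L1 L2 : lieAlgType F) := LieHom {
  lieHom_fun :> 'Hom(L1, L2);
  lieHomP : forall x y, lieHom_fun [l x, y] = [l lieHom_fun x, lieHom_fun y]
}.

Definition lie_incl (F : fieldType) (L : lieAlgType F) (s : lieSubalg L) :
  lieHom (subvs_of s) L.
Proof.
by exists (linfun (@vsval F L s)) => x y; rewrite !lfunE.
Defined.

Definition gl (F : fieldType) (n : nat) : Type := 'M[F]_n.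
HB.instance Definition _ (F : fieldType) n := Vector.on (gl F n).

Section GL.
Variables (F : fieldType) (n : nat).

Definition gl_lie (A B : gl F n) : gl F n := A *m B - B *m A.

Fact gl_lie_linearl B : linear (gl_lie^~ B).
Proof.
move=> a U V; rewrite /gl_lie mulmxDl mulmxDr -scalemxAl -scalemxAr.
by rewrite scalerBr opprD addrACA.
Qed.
Fact gl_lie_linearr A : linear (gl_lie A).
Proof.
move=> a U V; rewrite /gl_lie mulmxDl mulmxDr -scalemxAl -scalemxAr.
by rewrite scalerBr opprD addrACA.
Qed.
Fact gl_liexx A : gl_lie A A = 0.
Proof. exact: subrr. Qed.
Fact gl_lie_jacobi A B C :
  gl_lie A (gl_lie B C) + gl_lie B (gl_lie C A) + gl_lie C (gl_lie A B) = 0.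
Proof.
rewrite /gl_lie !mulmxBl !mulmxBr !mulmxA.
set x1 := A *m B *m C; set x2 := A *m C *m B; set x3 := B *m A *m C.
set x4 := B *m C *m A; set x5 := C *m A *m B; set x6 := C *m B *m A.
apply/matrixP => i j; rewrite !mxE; ring.
Qed.

HB.instance Definition _ := Vector_isLieAlgebra.Build F (gl F n)
  gl_lie_linearl gl_lie_linearr gl_liexx gl_lie_jacobi.

Definition trace0 : {vspace gl F n} :=
  lker (linfun (@mxtrace F n : gl F n -> F^o)).

Lemma trace0P (A : gl F n) : (A \in trace0) = (\tr A == 0).
Proof. by rewrite memv_ker lfunE. Qed.

Definition sl_subalg : lieSubalg (gl F n).
Proof.
exists trace0 => A B _ _.
by rewrite trace0P raddfB /= mxtrace_mulC subrr.
Defined.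

Definition sl := subvs_of sl_subalg.
HB.instance Definition _ := LieAlgebra.on sl.

End GL.

(* V / W for a subspace W of V: the library's type of cosets v + W, equipped *)
(* with its vector space structure; quotv_pi W v is the coset of v.          *)

Definition quotv (F : fieldType) (V : vectType F) (W : {vspace V}) : Type :=
  Quotient.quot (GRing.ZmodClosed.clone V (pred_of_vspace W) _).

Section QuotientSpace.
Variables (F : fieldType) (V : vectType F) (W : {vspace V}).

HB.instance Definition _ := GRing.Zmodule.on (quotv W).
HB.instance Definition _ := EqQuotient.on (quotv W).

Definition quotv_pi (v : V) : quotv W := \pi_(quotv W) v.

Lemma quotv_pi_eq u v : (quotv_pi u == quotv_pi v) = (u - v \in W).
Proof. by rewrite /quotv_pi -Quotient.idealrBE. Qed.

Fact quotv_pi_zmod_morphism : zmod_morphism quotv_pi.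
Proof. exact: (raddfB (\pi_(quotv W))). Qed.

Lemma quotv_reprK (q : quotv W) : quotv_pi (repr q) = q.
Proof. exact: reprK. Qed.

Lemma quotv_repr_pi v : repr (quotv_pi v) - v \in W.
Proof. by rewrite -quotv_pi_eq quotv_reprK. Qed.

Definition quotv_scale (a : F) (q : quotv W) : quotv W := quotv_pi (a *: repr q).

Fact quotv_scale_pi a v : quotv_scale a (quotv_pi v) = quotv_pi (a *: v).
Proof.
apply/eqP; rewrite quotv_pi_eq -scalerBr; exact/rpredZ/quotv_repr_pi.
Qed.

Fact quotv_scaleA a b q : quotv_scale a (quotv_scale b q) = quotv_scale (a * b) q.
Proof. by rewrite -[q]quotv_reprK !quotv_scale_pi scalerA. Qed.
Fact quotv_scale1 : left_id 1 quotv_scale.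
Proof. by move=> q; rewrite -[q]quotv_reprK quotv_scale_pi scale1r. Qed.
Fact quotv_piD u v : quotv_pi (u + v) = quotv_pi u + quotv_pi v.
Proof. exact: (raddfD (\pi_(quotv W))). Qed.
Fact quotv_scaleDr : right_distributive quotv_scale +%R.
Proof.
move=> a p q; rewrite -[p]quotv_reprK -[q]quotv_reprK -quotv_piD.
by rewrite !quotv_scale_pi scalerDr quotv_piD.
Qed.
Fact quotv_scaleDl q : {morph quotv_scale^~ q : a b / a + b}.
Proof.
by move=> a b; rewrite -[q]quotv_reprK !quotv_scale_pi scalerDl quotv_piD.
Qed.

HB.instance Definition _ := GRing.Zmodule_isLmodule.Build F (quotv W)
  quotv_scaleA quotv_scale1 quotv_scaleDr quotv_scaleDl.

Fact quotv_pi_linear : linear quotv_pi.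
Proof. by move=> a u v; rewrite quotv_piD -quotv_scale_pi. Qed.
HB.instance Definition _ := GRing.isLinear.Build F V (quotv W) _ quotv_pi
  quotv_pi_linear.

Fact quotv_vect_iso : Vector.axiom (\dim W^C) (quotv W).
Proof.
have dWC : (W^C :&: W = 0)%VS by rewrite capvC capv_compl.
have dCW : (W :&: W^C = 0)%VS := capv_compl W.
pose p := daddv_pi W^C W; pose p' := daddv_pi W W^C.
have pD v : p v + p' v = v.
  by apply: daddv_pi_add => //; rewrite addvC addv_complf memvf.
have p0 v : v \in W -> p v = 0.
  by move=> vW; apply: (addIr (p' v)); rewrite pD add0r /p' daddv_pi_id.
have pR v : p (repr (quotv_pi v)) = p v.
  by apply/eqP; rewrite -subr_eq0 -linearB /= p0 ?quotv_repr_pi.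
exists (fun q => \row_i coord (vbasis W^C) i (p (repr q))).
  move=> a x y; rewrite -[x]quotv_reprK -[y]quotv_reprK -linearP.
  by apply/rowP=> i; rewrite !mxE !pR !linearP.
exists (fun rw : 'rV_(\dim W^C) => quotv_pi (\sum_i rw 0 i *: (vbasis W^C)`_i)).
  move=> q; rewrite -[RHS]quotv_reprK; apply/eqP; rewrite quotv_pi_eq.
  rewrite -{2}(pD (repr q)) {2}(coord_vbasis (memv_pi _ W (repr q))).
  rewrite (eq_bigr _ (fun i _ => congr1 ( *:%R^~ _) (mxE _ _ _ _))).
  by rewrite opprD addrA subrr sub0r rpredN memv_pi.
move=> rw; apply/rowP=> i; rewrite mxE pR /p daddv_pi_id //.
  by rewrite coord_sum_free ?(basis_free (vbasisP _)).
by apply: rpred_sum => j _; rewrite rpredZ ?vbasis_mem ?memt_nth.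
Qed.
HB.instance Definition _ := Lmodule_hasFinDim.Build F (quotv W) quotv_vect_iso.

End QuotientSpace.

Record lieRep (F : fieldType) (L : lieAlgType F) (M : vectType F) := LieRep {
  rep_act :> L -> M -> M;
  rep_linearl : forall m, linear (rep_act^~ m);
  rep_linearr : forall x, linear (rep_act x);
  rep_lie : forall x y m,
    rep_act [l x, y] m = rep_act x (rep_act y m) - rep_act y (rep_act x m)
}.

Section Representations.
Variables (F : fieldType) (L : lieAlgType F) (M : vectType F).
Variable rho : lieRep L M.

Record submod := Submod {
  submod_vs :> {vspace M};
  submodP : forall x m, m \in submod_vs -> rho x m \in submod_vs
}.

Definition irreducible_rep : Prop :=
  {:M}%VS <> 0%VS /\
  forall U : submod, (U : {vspace M}) = 0%VS \/ (U : {vspace M}) = fullv.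

Definition rep_iso (M' : vectType F) (rho' : lieRep L M') : Prop :=
  exists2 f : 'Hom(M, M'), bijective f &
    forall x m, f (rho x m) = rho' x (f m).

Section SubRep.
Variable U : submod.

Definition sub_act (x : L) (m : subvs_of U) : subvs_of U :=
  Subvs (submodP x (subvsP m)).

Fact sub_act_linearl m : linear (sub_act^~ m).
Proof. by move=> a x y; apply/val_inj; rewrite /= rep_linearl. Qed.
Fact sub_act_linearr x : linear (sub_act x).
Proof. by move=> a m n; apply/val_inj; rewrite /= rep_linearr. Qed.
Fact sub_act_lie x y m :
  sub_act [l x, y] m = sub_act x (sub_act y m) - sub_act y (sub_act x m).
Proof. by apply/val_inj; rewrite /= rep_lie. Qed.

Definition sub_rep : lieRep L (subvs_of U) :=
  LieRep sub_act_linearl sub_act_linearr sub_act_lie.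

End SubRep.

Section Pullback.
Variables (L' : lieAlgType F) (phi : lieHom L' L).

Definition pull_act (x : L') (m : M) : M := rho (phi x) m.

Fact pull_act_linearl m : linear (pull_act^~ m).
Proof. by move=> a x y; rewrite /pull_act linearP rep_linearl. Qed.
Fact pull_act_linearr x : linear (pull_act x).
Proof. exact: rep_linearr. Qed.
Fact pull_act_lie x y m :
  pull_act [l x, y] m = pull_act x (pull_act y m) - pull_act y (pull_act x m).
Proof. by rewrite /pull_act lieHomP rep_lie. Qed.

Definition pull_rep : lieRep L' M :=
  LieRep pull_act_linearl pull_act_linearr pull_act_lie.

End Pullback.

End Representations.

Section QuotientRep.
Variables (F : fieldType) (g : lieAlgType F) (J : lieIdeal g).

Definition quot_act (x : g) (q : quotv J) : quotv J := quotv_pi J [l x, repr q].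

Lemma quot_act_pi x y : quot_act x (quotv_pi J y) = quotv_pi J [l x, y].
Proof.
apply/eqP; rewrite quotv_pi_eq -linearBr.
exact/lieIdealP/quotv_repr_pi.
Qed.

Fact quot_act_linearl q : linear (quot_act^~ q).
Proof. by move=> a x y; rewrite /quot_act linearPl linearP. Qed.
Fact quot_act_linearr x : linear (quot_act x).
Proof.
move=> a p q; rewrite -[p]quotv_reprK -[q]quotv_reprK -linearP /=.
by rewrite !quot_act_pi linearPr linearP.
Qed.
Fact quot_act_lie x y q :
  quot_act [l x, y] q = quot_act x (quot_act y q) - quot_act y (quot_act x q).
Proof.
rewrite -[q]quotv_reprK !quot_act_pi -linearB /=.
by rewrite lie_derivation addrK.
Qed.

Definition quot_rep : lieRep g (quotv J) :=
  LieRep quot_act_linearl quot_act_linearr quot_act_lie.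

(* I / J when J is contained in I, and (I + J) / J in general. *)
Definition factor_submod (I : lieIdeal g) : submod quot_rep.
Proof.
exists (linfun (quotv_pi J) @: I)%VS => x q /memv_imgP[y yI ->].
rewrite lfunE /= quot_act_pi -[quotv_pi J _]lfunE.
exact/memv_img/lieIdealP.
Defined.

Definition factor_rep (s : lieSubalg g) (I : lieIdeal g) :
    lieRep (subvs_of s) (subvs_of (factor_submod I)) :=
  pull_rep (sub_rep (factor_submod I)) (lie_incl s).

End QuotientRep.

(* V(n), irreducible in characteristic 0, is realised as the n-th symmetric  *)
(* power of the natural module F^2 with basis X, Y: the row (v_0, ..., v_n)  *)
(* stands for \sum_i v_i X^(n-i) Y^i, and a matrix with rows (a, b), (c, d)  *)
(* acts as the derivation X |-> a X + c Y, Y |-> b X + d Y.                  *)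

Section SymmetricPower.
Variables (F : fieldType) (n : nat).

Definition symn_mx (A : gl F 2) : 'M[F]_n.+1 := \matrix_(i, j)
  (((n - i)%:R * A 0 0 + i%:R * A 1 1) *+ (j == i)
   + ((n - i)%:R * A 1 0) *+ (j == i.+1 :> nat)
   + (i%:R * A 0 1) *+ (j.+1 == i :> nat)).


Fact symn_mx_linear : linear symn_mx.
Proof.
move=> a A B; apply/matrixP=> i j; rewrite !mxE.
by case: (j == i); case: (j == i.+1 :> nat); case: (j.+1 == i :> nat);
  rewrite !(mulr1n, mulr0n); ring.
Qed.

Let entry (A : gl F 2) (i j : nat) : F :=
  ((n - i)%:R * A 0 0 + i%:R * A 1 1) *+ (j == i)
  + ((n - i)%:R * A 1 0) *+ (j == i.+1) + (i%:R * A 0 1) *+ (j.+1 == i).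

Let sum_tridiag (i : 'I_n.+1) (a b c : F) (G : nat -> F) :
  (i = n :> nat -> b = 0) -> (i = 0%N :> nat -> c = 0) ->
  \sum_(j < n.+1) (a *+ (j == i) + b *+ (j == i.+1 :> nat)
                   + c *+ (j.+1 == i :> nat)) * G j
  = a * G i + b * G i.+1 + c * G i.-1.
Proof.
move=> b0 c0.
under eq_bigr => j _ do rewrite 2!mulrDl !mulrnAl !mulrb.
rewrite !big_split /=; congr (_ + _ + _).
- by rewrite -big_mkcond /= (big_pred1 i).
- have [lt_in|le_ni] := ltnP i n; last first.
    rewrite b0; last by apply/eqP; rewrite eqn_leq le_ni -ltnS ltn_ord.
    by rewrite mul0r big1 // => j _; rewrite mul0r if_same.
  by rewrite -big_mkcond /= (big_pred1 (Ordinal (lt_in : i.+1 < n.+1)%N)).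
- case: i c0 {b0} => -[|i] lt_in /= c0.
    by rewrite c0 // mul0r big1 // => j _; rewrite mul0r if_same.
  by rewrite -big_mkcond /= (big_pred1 (Ordinal (ltnW lt_in))).
Qed.

Let sum_symn_mx A (i : 'I_n.+1) (G : nat -> F) :
  \sum_j symn_mx A i j * G j =
  ((n - i)%:R * A 0 0 + i%:R * A 1 1) * G i
  + (n - i)%:R * A 1 0 * G i.+1 + i%:R * A 0 1 * G i.-1.
Proof.
under eq_bigr => j _ do rewrite mxE.
by rewrite sum_tridiag // => ->; rewrite ?subnn mul0r.
Qed.

Fact symn_mx_lie A B :
  symn_mx [l A, B] = symn_mx B *m symn_mx A - symn_mx A *m symn_mx B.
Proof.
have lieE p q : [l A, B] p q =
    A p 0 * B 0 q + A p 1 * B 1 q - (B p 0 * A 0 q + B p 1 * A 1 q).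
  have -> : [l A, B] = A *m B - B *m A by [].
  rewrite !mxE !big_ord_recl !big_ord0 !addr0.
  by have -> : lift ord0 ord0 = 1 :> 'I_2 by apply/val_inj.
move: [l A, B] lieE => AB lieE; apply/matrixP=> i k; rewrite !mxE.
have E C D : \sum_j symn_mx C i j * symn_mx D j k =
    ((n - i)%:R * C 0 0 + i%:R * C 1 1) * entry D i k
    + (n - i)%:R * C 1 0 * entry D i.+1 k + i%:R * C 0 1 * entry D i.-1 k.
  rewrite -(sum_symn_mx C i (fun j => entry D j k)).
  by apply: eq_bigr => j _; rewrite [symn_mx D j k]mxE.
rewrite !E /entry.
have natb (x : F) (b : bool) : x *+ b = x * (if b then 1 else 0).
  by case: b; rewrite ?mulr1 ?mulr0.
rewrite !lieE !natb.
have -> : (k == i) = (k == i :> nat) by [].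
move: (nat_of_ord k) => {E}{}k; case: i => i /= lt_in.
have [m def_n] : {m | n = (i + m)%N} by exists (n - i)%N; rewrite subnKC // -ltnS.
have -> : (n - i = m)%N by lia.
have -> : (n - i.+1 = m.-1)%N by lia.
case: i lt_in def_n => [|i] lt_in def_n /=; case: m def_n => [|m] def_n /=;
 rewrite ?eqSS.
3: have -> : (n - i = 1)%N by lia.
4: have -> : (n - i = m.+2)%N by lia.
all: repeat match goal with |- context [if ?b then _ else _] =>
  move: (if b then 1 else 0 : F) => ? end.
all: repeat match goal with |- context [fun_of_matrix ?M ?p ?q] =>
  move: (fun_of_matrix M p q) => ? end.
all: ring.
Qed.

End SymmetricPower.

Section Vn.
Variables (F : fieldType) (n : nat).

Definition Vn_act (A : sl F 2) (v : 'rV[F]_n.+1) : 'rV[F]_n.+1 :=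
  v *m symn_mx n (vsval A).

Fact Vn_act_linearl v : linear (Vn_act^~ v).
Proof.
move=> a A B.
by rewrite /Vn_act linearP symn_mx_linear mulmxDr -scalemxAr.
Qed.
Fact Vn_act_linearr A : linear (Vn_act A).
Proof. by move=> a u v; rewrite /Vn_act mulmxDl -scalemxAl. Qed.
Fact Vn_act_lie A B v :
  Vn_act [l A, B] v = Vn_act A (Vn_act B v) - Vn_act B (Vn_act A v).
Proof. by rewrite /Vn_act [vsval _]/= symn_mx_lie mulmxBr !mulmxA. Qed.

Definition Vn : lieRep (sl F 2) 'rV[F]_n.+1 :=
  LieRep Vn_act_linearl Vn_act_linearr Vn_act_lie.

End Vn.

Record quadForm (F : fieldType) (g : lieAlgType F) := QuadForm {
  quad_form :> {symmetric g};
  quad_nondeg : nondegenerate quad_form;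
  quad_inv : forall x y z, quad_form [l x, y] z = quad_form x [l y, z]
}.

Section Quadratic.
Variables (F : fieldType) (g : lieAlgType F) (B : quadForm g).

Definition irreducible_quadratic : Prop :=
  forall I : lieIdeal g,
    (I : {vspace g}) <> 0%VS -> (I : {vspace g}) <> fullv ->
    ~ (forall x, x \in I -> (forall y, y \in I -> B x y = 0) -> x = 0).

Definition orth_ideal (I : lieIdeal g) : lieIdeal g.
Proof.
exists (orthov B I) => x y /mem_orthovP yI; apply/mem_orthovP => v vI.
by rewrite lieC linearNl /= quad_inv yI ?oppr0 //; apply: lieIdealP.
Defined.

End Quadratic.

(* Main.v *)
Require Import Defs.
From HB Require Import structures.
From mathcomp Require Import all_boot all_order all_algebra.
From mathcomp Require Import ring zify.
From Stdlib Require Import Classical.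

Set Implicit Arguments.
Unset Strict Implicit.
Unset Printing Implicit Defensive.

Import GRing.Theory passmx.
Local Open Scope ring_scope.

(* Write J for the orthogonal of r. It is an ideal centralised by r, and        *)
(* irreducibility puts it inside r; since dim J = dim s, dim g is               *)
(* 2 dim s + dim (r / J) with dim (r / J) > 0, so dim s <= 6. If dim s = 6 then *)
(* dim (r / J) = 1 and g has a nonisotropic central vector, against             *)
(* irreducibility; hence dim s <= 5. A minimal nonsolvable subalgebra N of s    *)
(* has, by Lie's theorem, a solvable subalgebra M of codimension one, and the   *)
(* filtration of M by its successive stabilisers shows that N is sl2 modulo an  *)
(* ideal of dimension at most one. So s contains an sl2-triple; in dimension 4  *)
(* or 5 the decomposition of s under that triple would exhibit a solvable       *)
(* ideal, so s = sl2. An irreducible u = V(n) in r / J has n + 1 <= 7; for n    *)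
(* odd V(n) carries no nonzero invariant symmetric form, so the preimage of u   *)
(* in r is totally isotropic, whence 2 (n + 1 + 3) <= 13 and n = 1.             *)

(** * Subspaces and eigenvectors modulo a subspace *)

(** The dimension bound is used twice. By [perp_radical_sub], g is stacked from r^perp, r / r^perp
    and a copy of s, the outer two both of dimension dim s. [dim_factor_neq1] makes the nonzero
    middle at least two-dimensional, so dim s <= 5 and [small_semisimple_sl2] identifies s. With dim
    s = 3 the middle has dimension at most 7, which bounds n by 6, and [odd_factor_isotropic]
    excludes 3 and 5.

    The sl2-triple in s comes from thinking of N, with its subalgebra M of codimension one, as
    vector fields on a line: M consists of the fields vanishing at a point, and [filtration] records
    the order of vanishing. [filtration_stable] says that the symbols stop at order two, leaving
    d/dt, t d/dt and t^2 d/dt, which span sl2; [sl2_triple_mod_ideal] extracts them and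
    [sl2_triple_lift] removes the remaining ideal. Lie's theorem and highest weight theory
    ([lie_theorem_mod], [sl2_string]) are stated modulo a stable subspace W, so that they apply to
    quotients while computing with vectors upstairs. *)

Section LinearAlgebra.
Variables (F : fieldType) (V : vectType F).

Lemma scalar_sep (u v : V) : (forall phi : {scalar V}, phi u = phi v) -> u = v.
Proof.
move=> H; rewrite (coord_vbasis (memvf u)) (coord_vbasis (memvf v)).
by apply: eq_bigr => i _; congr (_ *: _); apply: (H (coord _ i)).
Qed.

Lemma scale_mem (W : {vspace V}) a v : a != 0 -> a *: v \in W -> v \in W.
Proof.
by move=> a0 H; rewrite -[v](scalerK a0) memvZ.
Qed.

Lemma memv_addlineP (W : {vspace V}) (u x : V) :
  reflect (exists c, x - c *: u \in W) (x \in W + <[u]>)%VS.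
Proof.
apply: (iffP idP) => [/memv_addP[w wW [_ /vlineP[c ->] ->]]|[c xc]].
  by exists c; rewrite addrK.
by rewrite -(subrK (c *: u) x) memv_add // memvZ ?memv_line.
Qed.

End LinearAlgebra.

(** Testing a vector identity against every linear functional turns it into an identity in F, which
    [ring] or [field] can settle. *)
Ltac linsep := apply: scalar_sep => phi;
  rewrite ?(linearD, linearB, linearN, linearZ, linear0) /=.

Section Eigen.
Variables (F : closedFieldType) (V : vectType F).

Lemma annihilating_seq n (A : 'M[F]_n) : exists cs : seq F,
  forall v : 'rV_n, foldr (fun c w => w *m A - c *: w) v cs = 0.
Proof.
case: n A => [|n] A; first by exists [::] => v; rewrite /= thinmx0.
have [cs def_p] := closed_field_poly_normal (char_poly A).
exists cs => v; have := Cayley_Hamilton A; rewrite def_p.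
rewrite (monicP (char_poly_monic A)) scale1r => /(congr1 (mulmx v)).
rewrite mulmx0 => <-; elim: cs {def_p} => [|c cs IH] /=.
  by rewrite big_nil rmorph1 mulmx1.
rewrite big_cons mulrC rmorphM /= -mulmxE mulmxA -IH rmorphB /=.
by rewrite horner_mx_X horner_mx_C mulmxBr mul_mx_scalar.
Qed.

(** By Cayley-Hamilton a product of factors T - c kills every vector. Applying the factors one at a
    time to a vector of U outside W, the last result still outside W is an eigenvector modulo W. *)
Lemma eigenvector_mod (T : 'End(V)) (U W : {vspace V}) :
  (forall v, v \in U -> T v \in U) -> (forall v, v \in W -> T v \in W) ->
  ~~ (U <= W)%VS ->
  exists v c, [/\ v \in U, v \notin W & T v - c *: v \in W].
Proof.
move=> TU TW /subvPn[v vU vW].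
have eB := vbasisP {:V}; have [cs Hcs] := annihilating_seq (mxof (vbasis _) (vbasis _) T).
have: foldr (fun c w => T w - c *: w) v cs \in W.
  suff -> : foldr (fun c w => T w - c *: w) v cs = 0 by rewrite mem0v.
  apply: (can_inj (rVofK eB)); rewrite linear0 -[RHS](Hcs (rVof (vbasis _) v)).
  by elim: cs {Hcs} => //= c cs <-; rewrite linearB linearZ /= (rVof_app _ eB).
have : forall w, w \in U -> w \notin W -> foldr (fun c w => T w - c *: w) w cs \in W ->
   exists v c, [/\ v \in U, v \notin W & T v - c *: v \in W].
  move=> w wU wW; elim: cs {Hcs} => [|c cs IH] /=; first by rewrite (negPf wW).
  set x := foldr _ _ _ in IH *.
  have [/IH//|xW] := boolP (x \in W).
  move=> H; exists x, c; split=> //.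
  rewrite /x; elim: (cs) => //= d ds IHd.
  by rewrite memvB ?TU ?memvZ.
exact.
Qed.

End Eigen.

(** * Extremal subspaces and separating functionals *)

Section ClassicalSubspaces.
Variables (F : fieldType) (V : vectType F).

Lemma maximal_vspace (Q : {vspace V} -> Prop) (W0 : {vspace V}) : Q W0 ->
  exists W, [/\ Q W, (W0 <= W)%VS &
    forall W', Q W' -> (W <= W')%VS -> (W' <= W)%VS].
Proof.
have [n] := ubnP (\dim {:V} - \dim W0); elim: n W0 => // n IH W0 lt_n QW0.
have [[W1 [QW1 sub01 nsub]]|H] :=
  classic (exists W1, [/\ Q W1, (W0 <= W1)%VS & ~~ (W1 <= W0)%VS]).
  have lt01 : (\dim W0 < \dim W1)%N.
    by rewrite ltn_neqAle dimvS // andbT (dimv_leqif_sup sub01).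
  have le1 : (\dim W1 <= \dim {:V})%N by rewrite dimvS ?subvf.
  have [|W [QW sub1 maxW]] := IH W1 _ QW1; first by lia.
  by exists W; split=> //; apply: subv_trans sub1.
exists W0; split=> // W' QW' sub; apply/negPn/negP => nsub.
by apply: H; exists W'.
Qed.

Lemma minimal_vspace (Q : {vspace V} -> Prop) (W0 : {vspace V}) : Q W0 ->
  exists W, [/\ Q W, (W <= W0)%VS &
    forall W', Q W' -> (W' <= W)%VS -> (W <= W')%VS].
Proof.
have [n] := ubnP (\dim W0); elim: n W0 => // n IH W0 lt_n QW0.
have [[W1 [QW1 sub10 nsub]]|H] :=
  classic (exists W1, [/\ Q W1, (W1 <= W0)%VS & ~~ (W0 <= W1)%VS]).
  have lt10 : (\dim W1 < \dim W0)%N.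
    by rewrite ltn_neqAle dimvS // andbT (dimv_leqif_sup sub10).
  have [|W [QW sub1 minW]] := IH W1 _ QW1; first by lia.
  by exists W; split=> //; apply: subv_trans sub1 _.
exists W0; split=> // W' QW' sub; apply/negPn/negP => nsub.
by apply: H; exists W'.
Qed.

(** Turns an undecidable linear condition into a genuine subspace: a maximal subspace inside P
    absorbs every vector satisfying P. *)
Lemma vspace_of_pred (P : V -> Prop) :
  P 0 -> (forall a u v, P u -> P v -> P (a *: u + v)) ->
  exists W : {vspace V}, forall v, v \in W <-> P v.
Proof.
move=> P0 Plin.
have [|W [QW _ maxW]] :=
  @maximal_vspace (fun W : {vspace V} => forall v, v \in W -> P v) 0%VS.
  by move=> v; rewrite memv0 => /eqP->.
exists W => v; split=> [|Pv]; first exact: QW.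
have sub : (W + <[v]> <= W)%VS.
  apply: maxW; last exact: addvSl.
  by move=> _ /memv_addP[w wW [_ /vlineP[c ->] ->]]; rewrite addrC; apply/Plin/QW.
by apply: (subvP sub); rewrite (subvP (addvSr _ _)) ?memv_line.
Qed.

Lemma separating_functional (W : {vspace V}) (v : V) : v \notin W ->
  exists mu : {scalar V}, mu v = 1 /\ forall w, w \in W -> mu w = 0.
Proof.
move=> vW; pose p := daddv_pi <[v]> W.
have v0 : v != 0 by apply: contraNneq vW => ->; rewrite mem0v.
have d0 : (<[v]> :&: W = 0)%VS.
  apply/eqP; rewrite -subv0; apply/subvP => x /memv_capP[/vlineP[c ->]].
  rewrite memv0 scaler_eq0 (negPf v0) orbF => H; apply: contraNT vW => c0.
  exact: scale_mem c0 H.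
have d0' : (W :&: <[v]> = 0)%VS by rewrite capvC.
pose e := [tuple v].
have fe : free e by rewrite seq1_free.
have line_coord c : coord e ord0 (c *: v) = c.
  by rewrite linearZ /= (coord_free ord0 ord0 fe) eqxx mulr1.
exists (coord e ord0 \o p : {scalar V}); split=> [|w wW] /=.
  by rewrite /p daddv_pi_id ?memv_line // -[v]scale1r line_coord.
suff -> : p w = 0 by rewrite linear0.
have /= := daddv_pi_add d0 (subvP (addvSr _ _) _ wW).
by rewrite [daddv_pi W _ w]daddv_pi_id // => /eqP; rewrite -subr_eq0 addrK => /eqP.
Qed.

End ClassicalSubspaces.

(** * Lie's theorem modulo a submodule *)

Section Hyperplane.
Variables (F : fieldType) (V : vectType F).

Lemma hyperplane_above (U W : {vspace V}) : (U <= W)%VS -> ~~ (W <= U)%VS ->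
  exists H z, [/\ (U <= H)%VS, (H + <[z]>)%VS = W & z \notin H].
Proof.
move=> UW nWU.
have [|H [[HW nWH] UH maxH]] :=
  @maximal_vspace _ _ (fun H : {vspace V} => (H <= W)%VS /\ ~~ (W <= H)%VS) U.
  by [].
have /subvPn[z zW zH] := nWH; exists H, z; split=> //.
apply/eqP; rewrite eqEsubv subv_add HW -memvE zW /=.
apply/negPn/negP => nW; have : (H + <[z]> <= H)%VS.
  apply: maxH; last exact: addvSl.
  by split=> //; rewrite subv_add HW -memvE.
by rewrite subv_add -memvE (negPf zH) andbF.
Qed.

Lemma dim_add_line (H : {vspace V}) z :
  z \notin H -> \dim (H + <[z]>) = (\dim H).+1.
Proof.
move=> zH; rewrite dimv_disjoint_sum ?dim_vline.
  by case: eqP zH => [->|_ _]; rewrite ?mem0v ?addn1.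
apply/eqP; rewrite -subv0; apply/subvP => x /memv_capP[xH /vlineP[c def_x]].
rewrite memv0 def_x scaler_eq0; apply: contraR zH => /norP[c0 _].
by apply: scale_mem c0 _; rewrite -def_x.
Qed.

End Hyperplane.

HB.instance Definition _ (F : fieldType) (L : lieAlgType F) (M : vectType F)
    (rho : lieRep L M) x :=
  GRing.isLinear.Build F M M _ (rep_act rho x) (rep_linearr rho x).

Section RepTheory.
Variables (F : fieldType) (L : lieAlgType F) (M : vectType F) (rho : lieRep L M).
Implicit Types (x y : L) (m : M).

Lemma repZDl a x y m : rho (a *: x + y) m = a *: rho x m + rho y m.
Proof. exact: rep_linearl. Qed.
Lemma repDl x y m : rho (x + y) m = rho x m + rho y m.
Proof. by rewrite -[x]scale1r repZDl !scale1r. Qed.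
Lemma rep0l m : rho 0 m = 0.
Proof. by apply: (addrI (rho 0 m)); rewrite -repDl !addr0. Qed.
Lemma repZl a x m : rho (a *: x) m = a *: rho x m.
Proof. by rewrite -[_ *: x]addr0 repZDl rep0l addr0. Qed.
Lemma repNl x m : rho (- x) m = - rho x m.
Proof. by rewrite -scaleN1r repZl scaleN1r. Qed.

End RepTheory.

Section LieArith.
Variables (F : fieldType) (L : lieAlgType F).
Implicit Types (x y z : L) (U V : {vspace L}).

Lemma lieDl x y z : [l x + y, z] = [l x, z] + [l y, z]. Proof. exact: linearDl. Qed.
Lemma lieDr x y z : [l x, y + z] = [l x, y] + [l x, z]. Proof. exact: linearDr. Qed.
Lemma lieZl a x z : [l a *: x, z] = a *: [l x, z]. Proof. exact: linearZl_LR. Qed.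
Lemma lieZr a x z : [l x, a *: z] = a *: [l x, z]. Proof. exact: linearZr_LR. Qed.
Lemma lieNl x z : [l - x, z] = - [l x, z]. Proof. exact: linearNl. Qed.
Lemma lieNr x z : [l x, - z] = - [l x, z]. Proof. exact: linearNr. Qed.
Lemma lie0l z : [l 0, z] = 0. Proof. exact: linear0l. Qed.
Lemma lie0r z : [l z, 0] = 0. Proof. exact: linear0r. Qed.

Lemma lie_memC U x y : ([l x, y] \in U) = ([l y, x] \in U).
Proof. by rewrite lieC memvN. Qed.

Lemma lie_derivationl x y z : [l [l x, y], z] = [l x, [l y, z]] - [l y, [l x, z]].
Proof. by rewrite lie_derivation addrK. Qed.

Fact ad_linearl z : linear (fun x => [l x, z]).
Proof. by move=> a x y; rewrite lieDl lieZl. Qed.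
Fact ad_linearr x : linear (lie x).
Proof. by move=> a y z; rewrite lieDr lieZr. Qed.
Definition ad_rep : lieRep L L := LieRep ad_linearl ad_linearr lie_derivationl.

Lemma lie_prodvS U1 U2 V1 V2 :
  (U1 <= U2)%VS -> (V1 <= V2)%VS -> (lie_prodv U1 V1 <= lie_prodv U2 V2)%VS.
Proof.
move=> U12 V12; apply/lie_prodvP => u v uU vV.
by apply: mem_lie_prodv; [apply: (subvP U12) | apply: (subvP V12)].
Qed.

Lemma derived_seriesS U V n :
  (U <= V)%VS -> (derived_series U n <= derived_series V n)%VS.
Proof. by move=> UV; elim: n => //= n IH; apply: lie_prodvS. Qed.

Lemma lie_solvableS U V : (U <= V)%VS -> lie_solvable V -> lie_solvable U.
Proof.
move=> UV [n Vn]; exists n; apply/eqP; rewrite -subv0 -Vn.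
exact: derived_seriesS.
Qed.

Lemma derived_seriesD U m n :
  derived_series U (m + n) = derived_series (derived_series U n) m.
Proof. by rewrite /derived_series iterD. Qed.

Lemma lie_abelian_solvable U :
  (forall x y, x \in U -> y \in U -> [l x, y] = 0) -> lie_solvable U.
Proof.
move=> H; exists 1%N; apply/eqP; rewrite -subv0; apply/lie_prodvP => x y xU yU.
by rewrite H ?mem0v.
Qed.

Lemma lie_prodv_le1 U : (\dim U <= 1)%N -> lie_prodv U U = 0%VS.
Proof.
move=> U1; apply/eqP; rewrite -subv0; apply/lie_prodvP => x y xU yU.
have [x0|x0] := eqVneq x 0; first by rewrite x0 lie0l mem0v.
suff /vlineP[c ->] : y \in <[x]>%VS by rewrite lieZr liexx scaler0 mem0v.
suff -> : (<[x]> = U)%VS by [].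
by apply/eqP; rewrite eqEdim dim_vline x0 -memvE xU.
Qed.

Lemma lie_solvable_mod U (W : {vspace L}) :
  (forall x y, x \in U -> y \in U -> [l x, y] \in W) ->
  lie_solvable W -> lie_solvable U.
Proof.
move=> H [n Wn]; exists n.+1; apply/eqP; rewrite -subv0 -Wn -addn1 derived_seriesD.
by apply: derived_seriesS; apply/lie_prodvP.
Qed.

Lemma lie_solvable_prodv U : lie_solvable U -> (U <= lie_prodv U U)%VS -> U = 0%VS.
Proof.
move=> [n Un] sub; apply/eqP; rewrite -subv0 -Un.
by elim: n {Un} => //= n IH; apply: subv_trans sub (lie_prodvS IH IH).
Qed.

End LieArith.

Section LieTheorem.
Variables (F : closedFieldType) (charF0 : [pchar F] =i pred0).
Variables (L : lieAlgType F) (V : vectType F) (rho : lieRep L V).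

Lemma natr_neq0 n : n.+1%:R != 0 :> F.
Proof. by have /pcharf0P -> := charF0. Qed.

Section Invariance.
Variables (K : {vspace L}) (x : L) (W : {vspace V}) (lam : L -> F) (u : V).
Hypothesis Kx : forall k, k \in K -> [l x, k] \in K.
Hypothesis KW : forall k w, k \in K -> w \in W -> rho k w \in W.
Hypothesis xW : forall w, w \in W -> rho x w \in W.
Hypothesis uW : u \notin W.
Hypothesis lamu : forall k, k \in K -> rho k u - lam k *: u \in W.

Let uu i := iter i (rho x) u.
Let S i := iteri i (fun j T => T + <[uu j]>)%VS W.

Let uuS i : uu i \in S i.+1.
Proof. by rewrite /= (subvP (addvSr _ _)) ?memv_line. Qed.

Let SS i : (S i <= S i.+1)%VS. Proof. exact: addvSl. Qed.

Let xS i w : w \in S i -> rho x w \in S i.+1.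
Proof.
elim: i w => [|i IH] w; first by move=> /xW; apply: (subvP (SS 0)).
move=> /memv_addP[w1 /IH w1S [_ /vlineP[c ->] ->]].
by rewrite linearD linearZ /= memv_add ?memvZ ?memv_line.
Qed.

(** The two claims are proved together: the second at i, which keeps one more term, yields the first
    at i + 1. *)
Let kuu i : forall k, k \in K ->
  rho k (uu i) - lam k *: uu i \in S i /\
  rho k (uu i.+1) - lam k *: uu i.+1 + (i.+1%:R * lam [l x, k]) *: uu i \in S i.
Proof.
elim: i => [|i IH] k kK.
  split; first exact: lamu.
  have H1 := xW (lamu kK); have H2 := lamu (Kx kK).
  have -> : rho k (uu 1) - lam k *: uu 1 + (1%:R * lam [l x, k]) *: uu 0 =
    rho x (rho k u - lam k *: u) - (rho [l x, k] u - lam [l x, k] *: u).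
    by rewrite /= rep_lie; linsep; ring.
  exact: memvB.
have [H1 H2] := IH _ kK; have [H3 _] := IH _ (Kx kK).
have A k' : k' \in K -> rho k' (uu i.+1) - lam k' *: uu i.+1 \in S i.+1.
  move=> /IH[_ H]; have := memvB (subvP (SS i) _ H) (memvZ (i.+1%:R * lam [l x, k']) (uuS i)).
  by rewrite addrK.
split; first exact: A.
have -> : rho k (uu i.+2) - lam k *: uu i.+2 + (i.+2%:R * lam [l x, k]) *: uu i.+1 =
   rho x (rho k (uu i.+1) - lam k *: uu i.+1 + (i.+1%:R * lam [l x, k]) *: uu i)
   - (rho [l x, k] (uu i.+1) - lam [l x, k] *: uu i.+1).
  by rewrite rep_lie /=; linsep; ring.
by rewrite memvB ?xS ?A ?Kx.
Qed.

Let SkW i k w : k \in K -> w \in S i.+1 -> rho k w - lam k *: w \in S i.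
Proof.
move=> kK; elim: i w => [|i IH] w /memv_addP[w1 w1S [_ /vlineP[c ->] ->]].
  have -> : rho k (w1 + c *: uu 0) - lam k *: (w1 + c *: uu 0) =
     (rho k w1 - lam k *: w1) + c *: (rho k u - lam k *: u).
     by linsep; ring.
  apply: memvD; last exact/memvZ/lamu.
  by apply: memvB; [exact: KW | exact: memvZ].
have -> : rho k (w1 + c *: uu i.+1) - lam k *: (w1 + c *: uu i.+1) =
   (rho k w1 - lam k *: w1) + c *: (rho k (uu i.+1) - lam k *: uu i.+1).
   by linsep; ring.
apply: memvD; first exact/(subvP (SS i))/IH.
by apply: memvZ; have [] := kuu i.+1 kK.
Qed.

(* In the chain W + <u, xu, ..., x^(i-1) u>, each k in K acts on x^i u modulo  *)
(* the previous step as lam k, and one step further down as - i lam [x, k].    *)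
Lemma weight_invariance k : k \in K -> lam [l x, k] = 0.
Proof.
move=> kK; have: exists n, uu n \in S n.
  apply: NNPP => /not_ex_all_not H.
  have dimS n : (n <= \dim (S n))%N.
    by elim: n => //= n IH; rewrite dim_add_line //; apply/negP/H.
  by have := dimvS (subvf (S (\dim {:V}).+1)); have := dimS (\dim {:V}).+1; lia.
case/ex_minnP => [[|n]] Sn minn; first by case/negP: uW.
apply/eqP/negPn/negP => lam0.
have [_ H] := kuu n kK; have H' := SkW kK Sn.
have: uu n \in S n.
  apply: (@scale_mem _ _ _ (n.+1%:R * lam [l x, k])).
    by rewrite mulf_neq0 ?natr_neq0.
  by have := memvB H H'; rewrite addrAC subrr add0r.
by move/minn; rewrite ltnn.
Qed.

End Invariance.

(** A functional that is 1 at v and 0 on W reads off the eigenvalues, so they can be chosen linearly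
    in x. *)
Lemma weight_function (M : {vspace L}) (W : {vspace V}) v : v \notin W ->
  (forall x, x \in M -> exists c, rho x v - c *: v \in W) ->
  exists lam : L -> F, (forall a x y, lam (a *: x + y) = a * lam x + lam y) /\
    forall x, x \in M -> rho x v - lam x *: v \in W.
Proof.
move=> /separating_functional[mu [muv muW]] H.
exists (fun x => mu (rho x v)); split=> [a x y|x /H[c Hc]].
  by rewrite repZDl linearD linearZ.
have /eqP := muW _ Hc; rewrite linearB linearZ /= muv mulr1 subr_eq0 => /eqP->.
by [].
Qed.

(** Induction on dim M. A hyperplane K of M containing [M, M] is an ideal, so it has a common
    eigenvector modulo W, of weight [lam]. The whole [lam]-weight space U' modulo W is stable under
    a complementary z, because [weight_invariance] makes [lam] vanish on [z, K]; an eigenvector of z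
    in U' then serves for M. *)
Theorem lie_theorem_mod (M : {vspace L}) (U W : {vspace V}) :
  (lie_prodv M M <= M)%VS -> lie_solvable M ->
  (forall x v, x \in M -> v \in U -> rho x v \in U) ->
  (forall x v, x \in M -> v \in W -> rho x v \in W) ->
  ~~ (U <= W)%VS ->
  exists v, [/\ v \in U, v \notin W &
    forall x, x \in M -> exists c, rho x v - c *: v \in W].
Proof.
have [n] := ubnP (\dim M); elim: n M U => // n IH M U lt_n subM solM MU MW nUW.
have [M0|M0] := eqVneq M 0%VS.
  have /subvPn[v vU vW] := nUW; exists v; split=> // x; rewrite M0 memv0 => /eqP->.
  by exists 0; rewrite rep0l scale0r subr0 mem0v.
have nM : ~~ (M <= lie_prodv M M)%VS.
  by apply/negP => /(lie_solvable_prodv solM) M0'; rewrite M0' eqxx in M0.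
have [K [z [MK def_M zK]]] := hyperplane_above subM nM.
have KM : (K <= M)%VS by rewrite -def_M addvSl.
have zM : z \in M by rewrite -def_M (subvP (addvSr _ _)) ?memv_line.
have Kid x k : x \in M -> k \in K -> [l x, k] \in K.
  by move=> xM kK; apply/(subvP MK)/mem_lie_prodv => //; apply: (subvP KM).
have [||||||v [vU vW Hv]] := IH K U => //.
- by move: lt_n; rewrite -def_M dim_add_line //; lia.
- by apply/lie_prodvP => x y xK; apply: Kid; apply: (subvP KM).
- exact: lie_solvableS KM solM.
- by move=> x w xK; apply/MU/(subvP KM).
- by move=> x w xK; apply/MW/(subvP KM).
have [lam [lin_lam Hlam]] := weight_function vW Hv.
have [|a w1 w2 [w1U H1] [w2U H2]|U' HU'] :=
  @vspace_of_pred _ _ (fun w => w \in U /\ forall k, k \in K -> rho k w - lam k *: w \in W).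
- by split=> [|k kK]; rewrite ?mem0v // raddf0 scaler0 subr0 mem0v.
- split=> [|k kK]; first by rewrite memvD ?memvZ.
  have -> : rho k (a *: w1 + w2) - lam k *: (a *: w1 + w2) =
    a *: (rho k w1 - lam k *: w1) + (rho k w2 - lam k *: w2) by linsep; ring.
  by rewrite memvD ?memvZ ?H1 ?H2.
have zU' w : w \in U' -> rho z w \in U'.
  move=> /HU'[wU Hw]; apply/HU'; split=> [|k kK]; first exact: MU.
  have [wW|wW] := boolP (w \in W).
    have zwW := MW _ _ zM wW.
    by rewrite memvB ?memvZ // MW // (subvP KM).
  have lam0 : lam [l z, k] = 0.
    apply: (@weight_invariance K z W lam w) => //.
    - by move=> k' k'K; apply: Kid.
    - by move=> k' w' k'K; apply/MW/(subvP KM).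
    - by move=> w'; apply: MW.
  have Hzk := Hw _ (Kid _ _ zM kK); rewrite lam0 scale0r subr0 in Hzk.
  have -> : rho k (rho z w) - lam k *: rho z w =
     rho z (rho k w - lam k *: w) - rho [l z, k] w.
    by rewrite rep_lie; linsep; ring.
  by rewrite memvB // MW // Hw.
have [||| v' [c [v'U v'W Hc]]] := @eigenvector_mod _ _ (linfun (rho z)) U' W.
- by move=> w wU; rewrite lfunE /= zU'.
- by move=> w wW; rewrite lfunE /= MW.
- apply/subvPn; exists v => //; apply/HU'; split=> // k kK; exact: Hlam.
have /HU'[v'U0 Hv'] := v'U; exists v'; split=> // x.
rewrite -def_M => /memv_addP[k kK [_ /vlineP[d ->] ->]].
exists (lam k + d * c); rewrite lfunE /= in Hc.
have -> : rho (k + d *: z) v' - (lam k + d * c) *: v' =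
   (rho k v' - lam k *: v') + d *: (rho z v' - c *: v').
  by rewrite repDl repZl; linsep; ring.
by rewrite memvD ?memvZ ?Hv'.
Qed.

End LieTheorem.

(** * Weight strings of sl2-triples *)

Section Flag.
Variables (F : fieldType) (V : vectType F) (W : {vspace V}).

Definition flag (v : nat -> V) i := iteri i (fun j T => T + <[v j]>)%VS W.

Lemma flag_mem v i j : (j < i)%N -> v j \in flag v i.
Proof.
elim: i => //= i IH; rewrite ltnS leq_eqVlt => /predU1P[->|/IH vj].
  by rewrite (subvP (addvSr _ _)) ?memv_line.
exact: (subvP (addvSl _ _)).
Qed.

Lemma flag_sub v i (U : {vspace V}) : (W <= U)%VS ->
  (forall j, (j < i)%N -> v j \in U) -> (flag v i <= U)%VS.
Proof.
move=> WU; elim: i => //= i IH vU; rewrite subv_add -memvE vU // andbT.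
by apply: IH => j ji; apply: vU; lia.
Qed.

Lemma flag_base v i : (W <= flag v i)%VS.
Proof. by elim: i => //= i IH; apply: subv_trans IH (addvSl _ _). Qed.

Variables (T : {linear V -> V}) (v : nat -> V) (lam : nat -> F).
Hypothesis TW : forall w, w \in W -> T w \in W.
Hypothesis Tv : forall i, T (v i) - lam i *: v i \in W.

Lemma flag_weight i y : y \in flag v i.+1 -> T y - lam i *: y \in flag v i.
Proof.
have Tflag k z : z \in flag v k -> T z \in flag v k.
  elim: k z => [|k IH] z /=; first exact: TW.
  move=> /memv_addP[z1 z1S [_ /vlineP[c ->] ->]].
  have -> : T (z1 + c *: v k) = (T z1 + c *: (T (v k) - lam k *: v k)) + (c * lam k) *: v k.
    by linsep; ring.
  apply: memv_add; last by rewrite memvZ ?memv_line.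
  by rewrite memvD ?IH // memvZ // (subvP (flag_base _ _)).
move=> /memv_addP[z1 z1S [_ /vlineP[c ->] ->]].
have -> : T (z1 + c *: v i) - lam i *: (z1 + c *: v i) =
  (T z1 - lam i *: z1) + c *: (T (v i) - lam i *: v i) by linsep; ring.
by rewrite memvD ?memvB ?Tflag ?memvZ // (subvP (flag_base _ _)).
Qed.

(** On the top step of the flag T acts as [lam i]; a vector of another weight [mu] must drop one
    step, and so on down to W. *)
Lemma flag_weight_mod i y mu : (forall j, (j < i)%N -> mu != lam j) ->
  y \in flag v i -> T y - mu *: y \in W -> y \in W.
Proof.
elim: i => //= i IH mu_lam yS Ty; apply: IH => // [j ji|].
  by apply: mu_lam; lia.
apply: (@scale_mem _ _ _ (mu - lam i)); first by rewrite subr_eq0 mu_lam.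
have -> : (mu - lam i) *: y = (T y - lam i *: y) - (T y - mu *: y).
  by linsep; ring.
by rewrite memvB ?flag_weight // (subvP (flag_base _ _)).
Qed.

Lemma dim_flag i : (forall j k, (j < k < i)%N -> lam j != lam k) ->
  (forall j, (j < i)%N -> v j \notin W) -> \dim (flag v i) = (\dim W + i)%N.
Proof.
elim: i => [|i IH] /= lam_inj vW; first by rewrite addn0.
rewrite dim_add_line; last first.
  apply: contra (vW _ (ltnSn i)) => vS; apply: flag_weight_mod vS (Tv i) => j ji.
  by rewrite eq_sym lam_inj // ji /=.
rewrite IH ?addnS // => [j k /andP[jk ki]|j ji]; [apply: lam_inj|apply: vW]; lia.
Qed.

End Flag.

Definition sl2_triple (F : fieldType) (L : lieAlgType F) (e h f : L) : Prop :=
  [/\ [l e, f] = h, [l h, e] = 2%:R *: e & [l h, f] = - (2%:R *: f)].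

Section SL2Triple.
Variables (F : closedFieldType) (charF0 : [pchar F] =i pred0).
Variables (L : lieAlgType F).

Variables (e h f : L) (tr : sl2_triple e h f).
Variables (V : vectType F) (rho : lieRep L V) (W : {vspace V}).
Hypothesis eW : forall w, w \in W -> rho e w \in W.
Hypothesis hW : forall w, w \in W -> rho h w \in W.
Hypothesis fW : forall w, w \in W -> rho f w \in W.

Lemma natr_inj : injective (fun n : nat => n%:R : F).
Proof.
have H i j : i%:R = j%:R :> F -> (i <= j)%N.
  rewrite leqNgt => E; apply/negP => lt_ji.
  have := natr_neq0 charF0 (i - j).-1; rewrite prednK ?subn_gt0 //.
  by rewrite natrB ?E ?subrr ?eqxx // ltnW.
by move=> i j E; apply/eqP; rewrite eqn_leq !H.
Qed.

(** Lie's theorem for the solvable algebra spanned by h and e gives a highest weight vector modulo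
    W. *)
Lemma borel_eigenvector (U : {vspace V}) :
  (forall u, u \in U -> rho e u \in U) -> (forall u, u \in U -> rho h u \in U) ->
  ~~ (U <= W)%VS ->
  exists v c, [/\ v \in U, v \notin W, rho h v - c *: v \in W & rho e v \in W].
Proof.
move=> eU hU nUW; have [_ he _] := tr.
pose M := (<[h]> + <[e]>)%VS.
have MM x y : x \in M -> y \in M -> [l x, y] \in <[e]>%VS.
  move=> /memv_addP[_ /vlineP[a ->] [_ /vlineP[b ->] ->]].
  move=> /memv_addP[_ /vlineP[c ->] [_ /vlineP[d ->] ->]].
  rewrite !(lieDl, lieDr, lieZl, lieZr) !liexx (lieC e h) he.
  rewrite !(scaler0, scalerN, scalerA, addr0, add0r).
  by rewrite memvD ?memvN ?memvZ ?memv_line.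
have stable (T : {vspace V}) : (forall u, u \in T -> rho e u \in T) ->
    (forall u, u \in T -> rho h u \in T) ->
    forall x v, x \in M -> v \in T -> rho x v \in T.
  move=> eT hT _ v /memv_addP[_ /vlineP[a ->] [_ /vlineP[b ->] ->]] vT.
  by rewrite repDl !repZl memvD ?memvZ ?eT ?hT.
have [||||| v [vU vW Hv]] := @lie_theorem_mod _ charF0 _ _ rho M U W => //.
- by apply/lie_prodvP => x y xM yM; apply: (subvP (addvSr _ _)) (MM _ _ xM yM).
- apply: (lie_solvable_mod MM); apply: lie_abelian_solvable => _ _ /vlineP[a ->] /vlineP[b ->].
  by rewrite lieZl lieZr liexx !scaler0.
- exact: stable.
- exact: stable.
have [c Hc] := Hv h (subvP (addvSl _ _) _ (memv_line _)).
have [d Hd] := Hv e (subvP (addvSr _ _) _ (memv_line _)).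
exists v, c; split=> //.
(* The eigenvalue d of e is zero modulo W: 2 e = [h, e] is a commutator, and commutators kill a
   common eigenvector modulo W. *)
have d0 : d *: v \in W.
  apply: (@scale_mem _ _ _ 2%:R); first exact: natr_neq0.
  have -> : 2%:R *: (d *: v) =
      rho h (rho e v - d *: v) - rho e (rho h v - c *: v)
      + (d *: (rho h v - c *: v) - c *: (rho e v - d *: v)) - 2%:R *: (rho e v - d *: v).
    have E : rho h (rho e v) = rho e (rho h v) + 2%:R *: rho e v.
      by rewrite -repZl -he rep_lie addrC subrK.
    by linsep; rewrite E ?(linearD, linearB, linearZ) /=; ring.
  apply: memvB; last exact: memvZ.
  apply: memvD; first by apply: memvB; [exact: hW | exact: eW].
  by apply: memvB; exact: memvZ.
by rewrite -(subrK (d *: v) (rho e v)) memvD.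
Qed.

Variables (v : V) (c : F).
Hypothesis vW : v \notin W.
Hypothesis hv : rho h v - c *: v \in W.
Hypothesis ev : rho e v \in W.

Definition f_orbit i := iter i (rho f) v.

Lemma h_orbit i : rho h (f_orbit i) - (c - i.*2%:R) *: f_orbit i \in W.
Proof.
have [_ _ hf] := tr.
elim: i => [|i IH]; first by rewrite subr0.
have -> : rho h (f_orbit i.+1) - (c - i.+1.*2%:R) *: f_orbit i.+1 =
   rho f (rho h (f_orbit i) - (c - i.*2%:R) *: f_orbit i); last exact: fW.
have E : rho h (rho f (f_orbit i)) = rho f (rho h (f_orbit i)) - 2%:R *: rho f (f_orbit i).
  by rewrite -repZl -repNl -hf rep_lie addrC subrK.
by rewrite /= E doubleS -addn2 natrD; linsep; ring.
Qed.

Lemma e_orbit i :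
  rho e (f_orbit i.+1) - (i.+1%:R * (c - i%:R)) *: f_orbit i \in W.
Proof.
have [ef _ _] := tr.
have E j : rho e (f_orbit j.+1) = rho h (f_orbit j) + rho f (rho e (f_orbit j)).
  by rewrite -ef rep_lie /= subrK.
elim: i => [|i IH].
  rewrite E.
  have -> : rho h (f_orbit 0) + rho f (rho e (f_orbit 0))
            - (1%:R * (c - 0%:R)) *: f_orbit 0 =
    (rho h v - c *: v) + rho f (rho e v) by linsep; ring.
  exact: memvD hv (fW ev).
rewrite E; have H := memvD (h_orbit i.+1) (fW IH).
have E2 : i.+1.*2%:R = 2%:R * i.+1%:R :> F by rewrite -muln2 natrM mulrC.
congr (_ \in W): H; rewrite linearB linearZ /= E2.
by rewrite -[rho f (f_orbit i)]/(f_orbit i.+1); linsep; ring.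
Qed.

(* The weights c - 2i are pairwise distinct, so some f^(n+1) v falls in W; for *)
(* the least n, e f^(n+1) v = (n+1) (c - n) f^n v modulo W forces c = n.       *)
Lemma sl2_string : exists n, [/\ c = n%:R, f_orbit n.+1 \in W,
  (forall i, (i <= n)%N -> f_orbit i \notin W)
  & \dim (flag W f_orbit n.+1) = (\dim W + n.+1)%N].
Proof.
have dimW i : (forall j, (j < i)%N -> f_orbit j \notin W) ->
    \dim (flag W f_orbit i) = (\dim W + i)%N.
  apply: (dim_flag hW h_orbit) => j k /andP[jk _].
  rewrite (inj_eq (addrI c)) (inj_eq oppr_inj) (inj_eq natr_inj).
  by apply: contraTneq jk => /double_inj->; rewrite ltnn.
have: exists n, f_orbit n \in W.
  apply: NNPP => /not_ex_all_not H.
  have dimS n := dimW n (fun j _ => introN idP (H j)).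
  by have := dimvS (subvf (flag W f_orbit (\dim {:V}).+1)); rewrite dimS; lia.
case/ex_minnP => [[|n]] Wn minn; first by case/negP: vW.
have Wi i : (i <= n)%N -> f_orbit i \notin W.
  by move=> le_in; apply/negP => /minn; lia.
exists n; split=> //; last exact: dimW.
apply/eqP/negPn/negP => cn; have /negP := Wi n (leqnn n); apply.
apply: (@scale_mem _ _ _ (n.+1%:R * (c - n%:R))).
  by rewrite mulf_neq0 ?natr_neq0 ?subr_eq0.
by have := memvB (eW Wn) (e_orbit n); rewrite subKr.
Qed.

End SL2Triple.

(** * Irreducible representations of sl2 *)

Section SL2.
Variable F : fieldType.

Lemma sl_eqP (A B : sl F 2) :
  vsval A 0 0 = vsval B 0 0 -> vsval A 0 1 = vsval B 0 1 ->
  vsval A 1 0 = vsval B 1 0 -> A = B.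
Proof.
move=> E00 E01 E10; apply: subvs_inj.
have tr (C : sl F 2) : vsval C 1 1 = - vsval C 0 0.
  have := subvsP C; rewrite trace0P /mxtrace !big_ord_recl big_ord0 addr0.
  have -> : lift ord0 ord0 = 1 :> 'I_2 by apply: val_inj.
  by rewrite addrC addr_eq0 => /eqP.
apply/matrixP => i j.
have dich (k : 'I_2) : k = 0 \/ k = 1.
  by case: k => [[|[|//]] ltk]; [left | right]; apply: val_inj.
by case: (dich i) => ->; case: (dich j) => -> //; rewrite !tr E00.
Qed.

Definition sl2_mx (a b c : F) : gl F 2 :=
  \matrix_(i, j) (if i == 0 then (if j == 0 then a else b)
                  else (if j == 0 then c else - a)).

Lemma sl2_mx_trace0 a b c : sl2_mx a b c \in sl_subalg F 2.
Proof.
rewrite trace0P /mxtrace !big_ord_recl big_ord0 !mxE /= addr0.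
by rewrite subrr.
Qed.

Definition sl2_elt a b c : sl F 2 := Subvs (sl2_mx_trace0 a b c).

Lemma sl2_elt00 a b c : vsval (sl2_elt a b c) 0 0 = a. Proof. by rewrite mxE. Qed.
Lemma sl2_elt01 a b c : vsval (sl2_elt a b c) 0 1 = b. Proof. by rewrite mxE. Qed.
Lemma sl2_elt10 a b c : vsval (sl2_elt a b c) 1 0 = c. Proof. by rewrite mxE. Qed.
Definition sl2_eltE := (sl2_elt00, sl2_elt01, sl2_elt10).

Lemma sl2_eltK (A : sl F 2) : sl2_elt (vsval A 0 0) (vsval A 0 1) (vsval A 1 0) = A.
Proof. by apply: sl_eqP; rewrite sl2_eltE. Qed.

Lemma sl2_lie a b c a' b' c' :
  [l sl2_elt a b c, sl2_elt a' b' c'] =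
  sl2_elt (b * c' - b' * c) (2%:R * (a * b' - a' * b)) (2%:R * (a' * c - a * c')).
Proof.
have vE (A B : sl F 2) : vsval [l A, B] = vsval A *m vsval B - vsval B *m vsval A by [].
by apply: sl_eqP; rewrite sl2_eltE vE !mxE !big_ord_recl !big_ord0 !mxE /=; ring.
Qed.

Lemma sl2_elt_sum a b c :
  sl2_elt a b c = a *: sl2_elt 1 0 0 + b *: sl2_elt 0 1 0 + c *: sl2_elt 0 0 1.
Proof. by apply: sl_eqP; rewrite !linearD !linearZ /= !mxE /=; ring. Qed.

Lemma sl2_elt_triple : sl2_triple (sl2_elt 0 1 0) (sl2_elt 1 0 0) (sl2_elt 0 0 1).
Proof.
split; rewrite sl2_lie; apply: sl_eqP;
  by rewrite ?linearN ?linearZ /= !mxE /= ?mxE /=; ring.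
Qed.

End SL2.

Section SL2Irreducible.
Variables (F : closedFieldType) (charF0 : [pchar F] =i pred0).
Variables (V : vectType F) (rho : lieRep (sl F 2) V).

Local Notation e := (sl2_elt (0 : F) 1 0).
Local Notation h := (sl2_elt (1 : F) 0 0).
Local Notation f := (sl2_elt (0 : F) 0 1).
Local Notation orb := (f_orbit f rho).

Definition sl2_standard_basis n (v : V) : Prop :=
  [/\ \dim {:V} = n.+1, flag 0 (orb v) n.+1 = fullv, orb v n.+1 = 0,
   forall i, rho h (orb v i) = (n%:R - i.*2%:R) *: orb v i
  & rho e v = 0 /\ forall i, rho e (orb v i.+1) = (i.+1%:R * (n%:R - i%:R)) *: orb v i].

Lemma sl2_rep_elt (A : sl F 2) u : rho A u =
  vsval A 0 0 *: rho h u + vsval A 0 1 *: rho e u + vsval A 1 0 *: rho f u.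
Proof. by rewrite -{1}[A]sl2_eltK sl2_elt_sum !repDl !repZl. Qed.

(** The f-string of a highest weight vector, taken with W = 0, spans a nonzero subspace stable under
    e, h and f, hence everything. *)
Lemma sl2_irreducible_basis : irreducible_rep rho ->
  exists n v, sl2_standard_basis n v.
Proof.
move=> [V0 irr]; have tr := sl2_elt_triple F.
have z0 (x : sl F 2) w : w \in (0%VS : {vspace V}) -> rho x w \in (0%VS : {vspace V}).
  by rewrite !memv0 => /eqP->; rewrite linear0.
have [||| v [c [_ v0 hv ev]]] :=
  borel_eigenvector charF0 tr (z0 e) (z0 h) (U := fullv).
- by move=> *; rewrite memvf.
- by move=> *; rewrite memvf.
- by rewrite subv0; apply/eqP.
have [n [def_c fn0 fi0 dimS]] := sl2_string charF0 tr (z0 e) (z0 h) (z0 f) v0 hv ev.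
have Hh := h_orbit tr (z0 f) hv.
have He := e_orbit tr (z0 f) hv ev.
have hE i : rho h (orb v i) = (n%:R - i.*2%:R) *: orb v i.
  by have := Hh i; rewrite memv0 subr_eq0 def_c => /eqP.
have eE i : rho e (orb v i.+1) = (i.+1%:R * (n%:R - i%:R)) *: orb v i.
  by have := He i; rewrite memv0 subr_eq0 def_c => /eqP.
have e0 : rho e v = 0 by apply/eqP; rewrite -memv0.
have fE : orb v n.+1 = 0 by apply/eqP; rewrite -memv0.
have stable A w : w \in flag 0 (orb v) n.+1 -> rho A w \in flag 0 (orb v) n.+1.
  have flag_stable (B : sl F 2) :
      (forall i, (i < n.+1)%N -> rho B (orb v i) \in flag 0 (orb v) n.+1) ->
      forall w, w \in flag 0 (orb v) n.+1 -> rho B w \in flag 0 (orb v) n.+1.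
    move=> HB u uS; rewrite -[rho B u](lfunE (rho B)).
    rewrite memv_preim; apply: (subvP _ _ uS); apply: flag_sub => [|j jn].
      exact: sub0v.
    by rewrite -memv_preim lfunE /= HB.
  move=> wS; rewrite sl2_rep_elt; do 2?apply: memvD; apply: memvZ;
    apply: flag_stable => // i lt_in.
  - by rewrite hE memvZ ?flag_mem.
  - case: i lt_in => [|i] lt_in; first by rewrite e0 mem0v.
    by rewrite eE memvZ // flag_mem // ltnW.
  - have [i_n|ni] := eqVneq i n; first by rewrite -[rho f _]/(orb v i.+1) i_n fE mem0v.
    by apply: (@flag_mem _ _ _ _ _ i.+1); lia.
have Sfull : flag 0 (orb v) n.+1 = fullv.
  have [S0|//] := irr (Submod stable).
  have S0' : flag 0 (orb v) n.+1 = 0%VS := S0.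
  by move: dimS; rewrite S0' !dimv0.
exists n, v; split=> //.
by rewrite -Sfull dimS dimv0.
Qed.

Section StandardBasis.
Variables (n : nat) (v : V) (std : sl2_standard_basis n v).

Lemma sl2_standard_basis_iso : rep_iso rho (Vn F n).
Proof.
have [dimV Sfull fn0 hE [e0 eE]] := std.
(* In V(n), f^i X^n is n! / (n - i)! times X^(n-i) Y^i; the factor (n - i)! makes x_i correspond to
   that monomial up to the common constant n!. *)
pose x i := (n - i)`!%:R *: orb v i.
have hx i : rho h (x i) = (n%:R - i.*2%:R) *: x i.
  by rewrite linearZ /= hE !scalerA mulrC.
have fx i : (i <= n)%N -> rho f (x i) = (n - i)%:R *: x i.+1.
  move=> le_in; rewrite linearZ /= -[rho f _]/(orb v i.+1) scalerA -natrM.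
  case: (ltngtP i n) le_in => // [lt_in|->] _; last by rewrite fn0 !scaler0.
  by rewrite (_ : n - i = (n - i.+1).+1)%N ?factS //; lia.
have ex i : (i <= n)%N -> rho e (x i) = i%:R *: x i.-1.
  case: i => [|i] lt_in; first by rewrite linearZ /= e0 scaler0 scale0r.
  rewrite linearZ /= eE !scalerA; congr (_ *: _).
  rewrite (_ : n - i = (n - i.+1).+1)%N ?factS; last by lia.
  by rewrite natrM -natrB ?(ltnW lt_in) // (_ : n - i = (n - i.+1).+1)%N; [ring|lia].
pose g (w : 'rV[F]_n.+1) := \sum_(i < n.+1) w 0 i *: x i.
have g_lin : linear g.
  move=> a u w; rewrite /g scaler_sumr -big_split; apply: eq_bigr => i _ /=.
  by rewrite !mxE; linsep; ring.
pose gl := GRing.isLinear.Build F _ _ _ g g_lin.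
pose gL : {linear 'rV[F]_n.+1 -> V} := HB.pack g gl.
pose G := linfun gL.
have GE w : G w = g w by rewrite lfunE.
have g_delta i : g (delta_mx 0 i) = x i.
  rewrite /g (bigD1 i) //= !mxE !eqxx scale1r big1 ?addr0 // => j ji.
  by rewrite mxE eqxx (negPf ji) scale0r.
have gV A w : g (Vn F n A w) = rho A (g w).
  have E : g (Vn F n A w) =
      \sum_(i < n.+1) w 0 i *: \sum_(j < n.+1) symn_mx n (vsval A) i j *: x j.
    rewrite /g; under eq_bigr => j _ do rewrite mxE scaler_suml.
    rewrite exchange_big; apply: eq_bigr => i _ /=.
    by rewrite scaler_sumr; apply: eq_bigr => j _; rewrite -scalerA.
  rewrite E /g linear_sum; apply: eq_bigr => i _ /=; rewrite linearZ /=; congr (_ *: _).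
  have le_in : (i <= n)%N by rewrite -ltnS.
  rewrite sl2_rep_elt hx ex ?fx // !scalerA.
  under eq_bigr => j _ do rewrite mxE 2!scalerDl.
  rewrite !big_split /=.
  have tr0 : vsval A 1 1 = - vsval A 0 0.
    by rewrite -[A]sl2_eltK !mxE.
  rewrite tr0.
  (* Selects one band of the tridiagonal matrix; at the ends i = 0 and i = n the missing neighbour
     has coefficient 0. *)
  have pick (c : F) (k : nat) (P : pred 'I_n.+1) :
      c = 0 \/ (k < n.+1)%N /\ (forall j, P j = (j == k :> nat)) ->
      \sum_(j < n.+1) (c *+ P j) *: x j = c *: x k.
    case=> [->|[lt_kn Pk]].
      by rewrite scale0r big1 // => j _; rewrite mul0rn scale0r.
    rewrite (bigD1 (Ordinal lt_kn)) //= Pk eqxx mulr1n big1 ?addr0 // => j jk.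
    by have /negPf jk' : j != k :> nat by []; rewrite Pk jk' mulr0n scale0r.
  rewrite (pick _ i); last by right.
  rewrite (pick _ i.+1); last first.
    case: (ltngtP i n) le_in => // [lt_in|->] _; first by right.
    by left; rewrite subnn mul0r.
  rewrite (pick _ i.-1); last first.
    case: (nat_of_ord i) (ltn_ord i) => [|k] lt_kn; first by left; rewrite mul0r.
    by right; split=> [|j]; [exact: ltnW | rewrite eqSS].
  have -> : n%:R - i.*2%:R = (n - i)%:R - i%:R :> F.
    by rewrite natrB // -muln2 natrM; ring.
  by linsep; ring.
have Glimg : limg G = fullv.
  apply/eqP; rewrite eqEsubv subvf -Sfull; apply: flag_sub => [|j lt_jn].
    exact: sub0v.
  apply: (@scale_mem _ _ _ (n - j)`!%:R).
    by have := fact_gt0 (n - j); case: _`! => // k _; exact: natr_neq0.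
  by rewrite -[_ *: _]/(x (Ordinal lt_jn)) -g_delta -GE memv_img ?memvf.
have G0 : lker G == 0%VS.
  have := limg_ker_dim G fullv; rewrite Glimg dimV capfv dimvf dim_matrix.
  by rewrite -dimv_eq0; lia.
have GK : cancel G G^-1%VF by exact: lker0_lfunK.
have KG : cancel G^-1%VF G by move=> u; rewrite limg_lfunVK // Glimg memvf.
exists G^-1%VF; first by exists G.
by move=> A u; apply: (can_inj GK); rewrite [RHS]GE gV -GE !KG.
Qed.

(** Invariance under h pairs f^i v only with f^(n-i) v. Moving f across gives b (f^i v, f^(n-i) v) =
    (-1)^i b (v, f^n v); at i = n, symmetry and odd n give b (v, f^n v) = - b (v, f^n v). *)
Lemma odd_standard_basis_form (b : V -> V -> F) : odd n ->
  (forall a u u' w, b (a *: u + u') w = a * b u w + b u' w) ->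
  (forall u w, b u w = b w u) ->
  (forall A u w, b (rho A u) w = - b u (rho A w)) ->
  forall u w, b u w = 0.
Proof.
move=> n_odd b_lin b_sym b_inv.
have [dimV Sfull fn0 hE _] := std.
have bZ a u w : b (a *: u) w = a * b u w.
  have b0 : b 0 w = 0.
    apply: (addrI (b 0 w)).
    by rewrite addr0 -{3}[0](addr0 0) -{3}[0]scale1r b_lin mul1r.
  by rewrite -[a *: u]addr0 b_lin b0 addr0.
have bN u w : b (- u) w = - b u w by rewrite -scaleN1r bZ mulN1r.
have two0 : 2%:R != 0 :> F := natr_neq0 charF0 1.
have b_opp i j : (i + j != n)%N -> b (orb v i) (orb v j) = 0.
  move=> ijn; have := b_inv h (orb v i) (orb v j).
  rewrite !hE bZ [b _ (_ *: _)]b_sym bZ [b (orb v j) _]b_sym -mulNr => /eqP.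
  rewrite -subr_eq0 -mulrBl mulf_eq0 => /orP[|/eqP//].
  have -> : n%:R - i.*2%:R - - (n%:R - j.*2%:R) = 2%:R * (n%:R - (i + j)%:R) :> F.
    by rewrite -!muln2 !natrM natrD; ring.
  rewrite mulf_eq0 (negPf two0) subr_eq0 /= => /eqP /(natr_inj charF0) E.
  by rewrite -E eqxx in ijn.
have b_flip i : b (orb v i) (orb v (n - i)) = (-1) ^+ i * b v (orb v n) \/ (i > n)%N.
  elim: i => [|i [IH|lt_ni]]; [by left; rewrite subn0 mul1r| |by right; lia].
  have [lt_in|] := ltnP i n; last by right; lia.
  left; rewrite exprS mulN1r mulNr -IH.
  rewrite -[orb v i.+1]/(rho f (orb v i)) b_inv; congr (- b _ _).
  by rewrite -[rho f _]/(orb v (n - i.+1).+1); congr (orb v _); lia.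
have b0n : b v (orb v n) = 0.
  have [|] := b_flip n; last by rewrite ltnn.
  rewrite subnn b_sym -signr_odd n_odd expr1 mulN1r => /eqP.
  rewrite -subr_eq0 opprK -mulr2n -mulr_natl mulf_eq0 (negPf two0) /=.
  by move/eqP.
have b0 i j : b (orb v i) (orb v j) = 0.
  have [ij|] := eqVneq (i + j)%N n; last exact: b_opp.
  have [|] := b_flip i; last by lia.
  by rewrite (_ : n - i = j)%N ?b0n ?mulr0 //; lia.
have orb_ind (P : V -> Prop) : (forall i, P (orb v i)) -> P 0 ->
    (forall a u u', P u -> P u' -> P (a *: u + u')) -> forall u, P u.
  move=> Porb P0 Plin u.
  have [T HT] := vspace_of_pred P0 Plin; apply/HT.
  apply: (subvP _ u (memvf u)); rewrite -Sfull.
  by apply: flag_sub => [|j _]; [exact: sub0v | apply/HT].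
have bw0 w : b 0 w = 0 by rewrite -(scale0r (0 : V)) bZ mul0r.
apply: (orb_ind (fun u => forall w, b u w = 0)) => [i| |a u u' IHu IHu' w] //.
  apply: (orb_ind (fun w => b (orb v i) w = 0)) => [j| |a w w' Hw Hw'];
    rewrite ?b0 // b_sym ?bw0 //.
  by rewrite b_lin ![b _ (orb v i)]b_sym Hw Hw' mulr0 addr0.
by rewrite b_lin IHu IHu' mulr0 addr0.
Qed.

End StandardBasis.

End SL2Irreducible.

(** * Solvable subalgebras of codimension one *)

Section Filtration.
Variables (F : closedFieldType) (charF0 : [pchar F] =i pred0).
Variables (L : lieAlgType F) (N M : {vspace L}) (v : L).
Hypothesis NN : forall x y, x \in N -> y \in N -> [l x, y] \in N.
Hypothesis MM : forall x y, x \in M -> y \in M -> [l x, y] \in M.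
Hypothesis def_N : (M + <[v]>)%VS = N.
Hypothesis vM : v \notin M.

(** In the model where v is d/dt and M consists of the fields vanishing at 0, these are the fields
    vanishing at 0 to order at least i + 1. *)
Definition filtration i : {vspace L} :=
  iter i (fun T => T :&: (linfun (ad_rep L v) @^-1: T))%VS M.
Local Notation "'L_ i" := (filtration i) (at level 8, i at level 2, format "''L_' i").

Lemma filtrationS i x : (x \in 'L_i.+1) = (x \in 'L_i) && ([l v, x] \in 'L_i).
Proof. by rewrite /filtration iterS memv_cap -memv_preim lfunE. Qed.

Lemma filtrationD i x : x \in 'L_i.+1 -> x \in 'L_i /\ [l v, x] \in 'L_i.
Proof. by rewrite filtrationS => /andP. Qed.

Lemma filtrationI i x : x \in 'L_i -> [l v, x] \in 'L_i -> x \in 'L_i.+1.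
Proof. by move=> xL Dx; rewrite filtrationS xL. Qed.

Lemma filtration_sub i j : (i <= j)%N -> ('L_j <= 'L_i)%VS.
Proof.
move/subnK <-; elim: (j - i)%N => // k; apply: subv_trans; exact: capvSl.
Qed.

Let vN : v \in N. Proof. by rewrite -def_N (subvP (addvSr _ _)) ?memv_line. Qed.
Let MN : (M <= N)%VS. Proof. by rewrite -def_N addvSl. Qed.

Let modM x : x \in N -> exists c m, m \in M /\ x = c *: v + m.
Proof.
rewrite -def_N => /memv_addP[m mM [_ /vlineP[c ->] ->]].
by exists c, m; rewrite addrC.
Qed.

Let LN i : ('L_i <= N)%VS.
Proof. exact: subv_trans (filtration_sub (leq0n i)) MN. Qed.

Let DN x : x \in N -> [l v, x] \in N. Proof. exact: NN. Qed.

Lemma filtration_lieM i x y : x \in M -> y \in 'L_i -> [l x, y] \in 'L_i.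
Proof.
elim: i x y => [|i IH] x y xM; first exact: MM.
rewrite !filtrationS => /andP[yL DyL]; rewrite (IH x y) //=.
rewrite lie_derivation; apply: memvD; last exact: IH.
have [c [m [mM ->]]] := modM (DN (subvP MN _ xM)).
by rewrite lieDl lieZl; apply: memvD; [exact: memvZ | exact: IH].
Qed.

Lemma filtration_lieN i x y : x \in N -> y \in 'L_i.+1 -> [l x, y] \in 'L_i.
Proof.
move=> /modM[c [m [mM ->]]] yL; have := yL; rewrite filtrationS => /andP[yL' DyL].
by rewrite lieDl lieZl; apply: memvD; [exact: memvZ | exact: filtration_lieM].
Qed.

Lemma filtration_lie i j x y : x \in 'L_i -> y \in 'L_j -> [l x, y] \in 'L_(i + j).
Proof.
elim: i j x y => [|i IHi] j x y; first exact: filtration_lieM.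
elim: j y => [|j IHj] y xL yL.
  by rewrite addn0 lie_memC filtration_lieM.
have [yL' Dy] := filtrationD yL; have [xL' Dx] := filtrationD xL.
rewrite addnS filtrationS (IHj y) //= lie_derivation; apply: memvD; last exact: IHj.
by have := IHi j.+1 _ _ Dx yL; rewrite addnS.
Qed.

(** L_1 is the kernel in M of the v-coefficient of [v, x], so M / L_1 is at most a line, spanned by
    h as soon as that coefficient a of h is nonzero. *)
Lemma filtration_line0 h m a x : h \in M -> m \in M -> a != 0 ->
  [l v, h] = a *: v + m -> x \in M -> x \in ('L_1 + <[h]>)%VS.
Proof.
move=> hM mM a0 def_a xM; have [c [m' [mM' Dx]]] := modM (DN (subvP MN _ xM)).
apply/memv_addlineP; exists (c / a) => //.
apply: filtrationI; first by rewrite memvB ?memvZ.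
rewrite lieDr lieNr lieZr Dx def_a.
have -> : c *: v + m' - (c / a) *: (a *: v + m) = m' - (c / a) *: m.
  by rewrite -{1}(divfK a0 c); linsep; field.
by rewrite memvB ?memvZ.
Qed.

Lemma top_coefficient h : h \in M -> h \notin 'L_1 ->
  exists a m, [/\ a != 0, m \in M & [l v, h] = a *: v + m].
Proof.
move=> hM hL; have [a [m [mM Dh]]] := modM (DN (subvP MN _ hM)).
exists a, m; split=> //; apply: contra hL => /eqP a0.
by apply: filtrationI => //; rewrite Dh a0 scale0r add0r.
Qed.

Section TopWeight.
Variables (e h m : L) (a : F).
Hypothesis eL : e \in 'L_1.
Hypothesis def_h : [l e, v] = h.
Hypothesis def_a : [l v, h] = a *: v + m.
Hypothesis mM : m \in M.
Hypothesis a0 : a != 0.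

Let De : [l v, e] = - h. Proof. by rewrite lieC def_h. Qed.
Let hM : h \in M.
Proof. by have := eL; rewrite filtrationS De memvN => /andP[]. Qed.

(** Since [v, [h, x]] = [h, [v, x]] + [[v, h], x] and [v, h] is a v modulo M, each level adds a to
    the weight of h. *)
Lemma filtration_weight i x : x \in 'L_i ->
  [l h, x] - (i%:R * a) *: x \in 'L_i.+1.
Proof.
elim: i x => [|i IH] x xL.
  rewrite mul0r scale0r subr0; apply: filtrationI; first exact: MM.
  have [c [m' [mM' Dx]]] := modM (DN (subvP MN _ xL)).
  rewrite lie_derivation def_a Dx.
  have -> : [l a *: v + m, x] + [l h, c *: v + m'] =
     a *: m' + [l m, x] - c *: m + [l h, m'].
    rewrite lieDl lieZl Dx lieDr lieZr [[l h, v]]lieC def_a; linsep; ring.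
  apply: memvD; last exact: MM.
  apply: memvB; last exact: memvZ.
  by apply: memvD; [exact: memvZ | exact: MM].
have [xL' Dx] := filtrationD xL; apply: filtrationI.
  by apply: memvB; [exact: filtration_lieM | exact: memvZ].
have -> : [l v, [l h, x] - (i.+1%:R * a) *: x] =
   ([l h, [l v, x]] - (i%:R * a) *: [l v, x]) + [l m, x].
  rewrite lieDr lieNr lieZr lie_derivation def_a lieDl lieZl; linsep; ring.
by apply: memvD; [exact: IH | exact: filtration_lieM].
Qed.

Lemma filtration_line1 x : x \in 'L_1 -> x \in ('L_2 + <[e]>)%VS.
Proof.
move=> xL; have [xM DxM] := filtrationD xL.
have [c [m' [mM' DDx]]] := modM (DN (subvP MN _ DxM)).
apply/memv_addlineP; exists (- (c / a)) => //.
rewrite scaleNr opprK; apply: filtrationI; first by rewrite memvD ?memvZ.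
apply: filtrationI; first by rewrite lieDr lieZr De memvD ?memvZ ?memvN.
rewrite !(lieDr, lieZr) De lieNr def_a DDx.
have -> : c *: v + m' + (c / a) *: (- (a *: v + m)) = m' - (c / a) *: m.
  by rewrite -{1}(divfK a0 c); linsep; field.
by rewrite memvB ?memvZ.
Qed.

(* tri k = 2 + 3 + ... + (k + 1) *)
Let tri k := iteri k (fun j t => t + j.+2)%N 0%N.

(** Induction through [v, [e, x]] = [e, [v, x]] - [h, x], where at the step from k to k + 1 the
    h-term contributes the weight (k + 2) a. For k = 0, x is a multiple of e modulo L_2, and [e, e]
    = 0. *)
Let De_tri k x : x \in 'L_k.+1 ->
  [l v, [l e, x]] + ((tri k)%:R * a) *: x \in 'L_k.+2.
Proof.
elim: k x => [|k IH] x xL.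
  rewrite mul0r scale0r addr0.
  have /memv_addlineP[c x'L] := filtration_line1 xL.
  have -> : [l e, x] = [l e, x - c *: e] by rewrite lieDr lieNr lieZr liexx scaler0 subr0.
  exact: (filtrationD (filtration_lie eL x'L)).2.
have [xL' Dx] := filtrationD xL.
have yL : [l e, [l v, x]] + ((tri k)%:R * a) *: x \in 'L_k.+3.
  apply: filtrationI.
    apply: memvD; last exact: memvZ.
    by have := filtration_lie eL Dx; rewrite add1n.
  by rewrite lieDr lieZr IH.
have -> : [l v, [l e, x]] + ((tri k.+1)%:R * a) *: x =
   ([l e, [l v, x]] + ((tri k)%:R * a) *: x) - ([l h, x] - (k.+2%:R * a) *: x).
  rewrite lie_derivation De lieNl /= natrD; linsep; ring.
by apply: memvB => //; apply: filtration_weight.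
Qed.

(** The chain stabilises by dimension. If it first did so at k + 2 with k > 0, then for x in L_(k+1)
    the bracket [e, x] would fall into L_(k+3), so [v, [e, x]] into L_(k+2); by [De_tri] a nonzero
    multiple of x would be there too, so the chain would have stopped one step earlier. *)
Lemma filtration_stable : ('L_2 <= 'L_3)%VS.
Proof.
have mono k : ('L_k <= 'L_k.+1)%VS -> ('L_k.+1 <= 'L_k.+2)%VS.
  by move=> sub; apply: capvS => //; apply: lpreimS.
have: exists k, ('L_k <= 'L_k.+1)%VS.
  apply: NNPP => /not_ex_all_not H.
  have dimL k : (\dim ('L_k) + k <= \dim M)%N.
    elim: k => [|k IH]; first by rewrite addn0.
    suff : (\dim ('L_k.+1) < \dim ('L_k))%N by lia.
    rewrite ltn_neqAle (dimv_leqif_sup (filtration_sub (leqnSn k))).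
    by rewrite (dimvS (filtration_sub (leqnSn k))) andbT; apply/negP/H.
  by have := dimL (\dim M).+1; lia.
case/ex_minnP => k subk mink.
have [le_k2|lt_2k] := leqP k 2.
  by case: k subk {mink} le_k2 => [|[|[|]]] // => [/mono/mono|/mono].
case: k lt_2k subk mink => [|[|k]] // lt_0k subk mink.
suff /mink : ('L_k.+1 <= 'L_k.+2)%VS by rewrite ltnn.
apply/subvP => x xL; apply: (@scale_mem _ _ _ ((tri k)%:R * a)).
  rewrite mulf_neq0 //; case: k lt_0k {subk mink xL} => // k _ /=.
  by rewrite addnS natr_neq0.
have ex : [l e, x] \in 'L_k.+3 by apply: (subvP subk); have := filtration_lie eL xL.
have := ex; case/filtrationD=> _ Dex.
by have := memvB (De_tri xL) Dex; rewrite addrC addKr.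
Qed.

End TopWeight.

(** If L_1 = L_2, then L_1 is a solvable ideal of N and N / L_1 is spanned by v and at most one
    further h; an algebra of dimension at most two is solvable, so N would be. *)
Lemma filtration_strict :
  lie_solvable M -> ~ lie_solvable N -> ~~ ('L_1 <= 'L_2)%VS.
Proof.
move=> solM nsolN; apply/negP => sub12; apply: nsolN.
have L1N x y : x \in N -> y \in 'L_1 -> [l x, y] \in 'L_1.
  by move=> xN yL; apply: filtration_lieN => //; apply: (subvP sub12).
have solL1 : lie_solvable 'L_1 := lie_solvableS (filtration_sub (leq0n 1)) solM.
have [sub01|/subvPn[h hM hL]] := boolP (M <= 'L_1)%VS.
  apply: lie_solvable_mod solL1 => x y /modM[c [m [mM ->]]] yN.
  have [d [m' [mM' ->]]] := modM yN.
  have vm n : n \in M -> [l v, n] \in 'L_1 by move=> nM; apply/L1N/(subvP sub01).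
  rewrite !(lieDl, lieDr, lieZl, lieZr) liexx !scaler0 add0r (lieC m v).
  by rewrite !memvD ?memvZ ?memvN ?vm // L1N ?(subvP MN) // (subvP sub01).
have [a [m [a0 mM Dh]]] := top_coefficient hM hL.
have decN x : x \in N -> exists c d x1, x1 \in 'L_1 /\ x = c *: v + d *: h + x1.
  move=> /modM[c [n [nM ->]]].
  have /memv_addlineP[d x1L] := filtration_line0 hM mM a0 Dh nM.
  exists c, d, (n - d *: h); split=> //; linsep; ring.
have decL x c d x1 y c' d' y1 : x1 \in 'L_1 -> y1 \in 'L_1 -> x \in N -> y \in N ->
    x = c *: v + d *: h + x1 -> y = c' *: v + d' *: h + y1 ->
    [l x, y] \in ('L_1 + <[ [l v, h] ]>)%VS.
  move=> x1L y1L xN yN def_x def_y.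
  have -> : [l x, y] = ([l x, y1] - [l y - y1, x1]) + (c * d' - c' * d) *: [l v, h].
    rewrite {1 2}def_x def_y addrK !(lieDl, lieDr, lieZl, lieZr) !liexx.
    by rewrite [[l h, v]]lieC [[l x1, v]]lieC [[l x1, h]]lieC; linsep; ring.
  apply: memv_add; last by rewrite memvZ ?memv_line.
  rewrite memvB ?L1N // memvB // (subvP MN) //.
  exact: (subvP (filtration_sub (leq0n 1))).
have decD x y : x \in N -> y \in N -> [l x, y] \in ('L_1 + <[ [l v, h] ]>)%VS.
  move=> xN yN; have [c [d [x1 [x1L def_x]]]] := decN _ xN.
  have [c' [d' [y1 [y1L def_y]]]] := decN _ yN.
  exact: decL x1L y1L xN yN def_x def_y.
apply: lie_solvable_mod decD _; apply: lie_solvable_mod solL1 => x y.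
move=> /memv_addP[x1 x1L [_ /vlineP[c ->] ->]] /memv_addP[y1 y1L [_ /vlineP[d ->] ->]].
have kN : [l v, h] \in N by apply/DN/(subvP MN).
have x1N : x1 \in N by apply: (subvP (LN 1)).
rewrite !(lieDl, lieDr, lieZl, lieZr) liexx !scaler0 addr0 (lieC x1 [l v, h]).
by rewrite !memvD ?memvZ ?memvN ?L1N.
Qed.

(** The ideal is L_2, stable by [filtration_stable]; e spans L_1 modulo L_2, h = [e, v] spans M
    modulo L_1, and f is v corrected by a multiple of e. Both e and v still need normalising against
    h. *)
Lemma sl2_triple_mod_ideal : lie_solvable M -> ~ lie_solvable N ->
  exists (I : {vspace L}) (e h f : L),
  [/\ (I <= M)%VS /\ (forall x y, x \in N -> y \in I -> [l x, y] \in I),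
      [/\ e \in N, h \in N, f \in N & e \notin I],
      [/\ [l e, f] = h, [l h, e] - 2%:R *: e \in I & [l h, f] + 2%:R *: f \in I]
    & \dim N = (\dim I).+3].
Proof.
move=> solM nsolN; have /subvPn[e eL eL2] := filtration_strict solM nsolN.
pose h := [l e, v]; have [eM De] := filtrationD eL.
have hM : h \in M by rewrite /h lieC memvN.
have hL : h \notin 'L_1.
  by apply: contra eL2 => hL; apply: filtrationI => //; rewrite lieC memvN.
have [a [m [a0 mM Dh]]] := top_coefficient hM hL.
have stable := filtration_stable eL (erefl h) Dh mM a0.
have I_ideal x y : x \in N -> y \in 'L_2 -> [l x, y] \in 'L_2.
  by move=> xN yL; apply: filtration_lieN => //; apply: (subvP stable).
have eN := subvP MN _ eM; have hN := subvP MN _ hM.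
have two0 : 2%:R != 0 :> F := natr_neq0 charF0 1.
have /memv_addlineP[b m1L] := filtration_line0 hM mM a0 Dh mM.
have /memv_addlineP[c m2L] := filtration_line1 eL (erefl h) Dh mM a0 m1L.
set m2 := _ - _ in m2L; have {m1L} def_m : m = b *: h + c *: e + m2.
  by rewrite /m2; linsep; ring.
clearbody m2; have := filtration_weight eL (erefl h) Dh mM eL; rewrite mul1r.
set w := _ - _ => wL; have he : [l h, e] = a *: e + w by rewrite /w addrC subrK.
clearbody w.
have hv : [l h, v] = - (a *: v + m) by rewrite lieC Dh.
(* The Jacobi identity for e, h, v puts b a e into L_2, while e lies outside. *)
have b0 : b = 0.
  apply/eqP/negPn/negP => b0; case/negP: eL2.
  apply: (@scale_mem _ _ _ (b * a)); first by rewrite mulf_neq0.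
  have -> : (b * a) *: e = [l e, m2] + [l v, w] - b *: w; last first.
    by rewrite memvB ?memvD ?memvZ ?I_ideal.
  have := lie_jacobi e h v; rewrite [[l v, e]]lieC -/h lieNr liexx oppr0 addr0.
  rewrite [[l e, h]]lieC lieNr he hv def_m.
  rewrite !(lieDr, lieNr, lieZr) liexx -/h [[l e, h]]lieC [[l v, e]]lieC -/h he.
  move=> E; apply/eqP; rewrite -subr_eq0; apply/eqP; rewrite -{}E.
  by linsep; ring.
rewrite {}b0 scale0r add0r in def_m.
(* Modulo L_2, [h, v] = - a v - c e and [h, e] = a e; this multiple of e is the one that makes f0
   have weight - a. *)
pose f0 := v + (c / (2%:R * a)) *: e.
have ef0 : [l e, f0] = h by rewrite /f0 lieDr lieZr liexx scaler0 addr0.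
have hf0 : [l h, f0] + a *: f0 \in 'L_2.
  have -> : [l h, f0] + a *: f0 = (c / (2%:R * a)) *: w - m2.
    by rewrite /f0 lieDr lieZr he hv def_m; linsep; field; rewrite two0 a0.
  by rewrite memvB ?memvZ.
have f0N : f0 \in N by rewrite memvD ?memvZ.
clearbody f0.
(* Scaling h by 2 / a turns the weights a and - a into 2 and - 2; scaling f0 alike preserves [e, f]
   = h. *)
exists 'L_2, e, ((2%:R / a) *: h), ((2%:R / a) *: f0); split.
- by split=> //; exact: filtration_sub (leq0n 2).
- by split; rewrite ?memvZ.
- rewrite !(lieZl, lieZr) ef0; split=> //.
    have -> : (2%:R / a) *: [l h, e] - 2%:R *: e = (2%:R / a) *: w.
      by rewrite he; linsep; field.
    by rewrite memvZ.
  have -> : (2%:R / a) *: ((2%:R / a) *: [l h, f0]) + 2%:R *: ((2%:R / a) *: f0) =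
     ((2%:R / a) * (2%:R / a)) *: ([l h, f0] + a *: f0).
    by linsep; field.
  by rewrite memvZ.
rewrite -def_N dim_add_line //; congr _.+1.
have -> : M = ('L_1 + <[h]>)%VS.
  have L1M : ('L_1 <= M)%VS := filtration_sub (leq0n 1).
  apply/eqP; rewrite eqEsubv subv_add L1M -memvE hM !andbT.
  by apply/subvP => x; exact: filtration_line0 hM mM a0 Dh.
rewrite dim_add_line //; congr _.+1.
rewrite -(dim_add_line eL2); congr (\dim _).
apply/eqP; rewrite eqEsubv subv_add (filtration_sub (leqnSn 1)) -memvE eL !andbT.
by apply/subvP => x xL; have := filtration_line1 eL (erefl h) Dh mM a0 xL.
Qed.

End Filtration.

(** * Semisimple Lie algebras of dimension at most five *)

Section SmallSemisimple.
Variables (F : closedFieldType) (charF0 : [pchar F] =i pred0).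
Variable (L : lieAlgType F).

Definition lie_closed (U : {vspace L}) : Prop :=
  forall x y, x \in U -> y \in U -> [l x, y] \in U.

Lemma lie_prodv_closed U : lie_closed U -> (lie_prodv U U <= U)%VS.
Proof. by move=> UU; apply/lie_prodvP. Qed.

(* Lie's theorem applied to a maximal proper subalgebra M acting on N / M      *)
(* produces a subalgebra M + <v>, so M has codimension 1.                      *)
Lemma minimal_nonsolvable_codim1 (N : {vspace L}) :
  lie_closed N -> ~ lie_solvable N ->
  (forall U, lie_closed U -> ~ lie_solvable U -> (U <= N)%VS -> (N <= U)%VS) ->
  exists M v, [/\ lie_closed M, lie_solvable M, (M + <[v]>)%VS = N & v \notin M].
Proof.
move=> NN nsolN minN.
pose Q (M : {vspace L}) := [/\ lie_closed M, (M <= N)%VS & ~~ (N <= M)%VS].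
have [|M [[MM MN nNM] _ maxM]] := @maximal_vspace _ _ Q 0%VS.
  split; first by move=> x y; rewrite !memv0 => /eqP-> _; rewrite lie0l.
    exact: sub0v.
  rewrite subv0; apply/eqP => N0; apply: nsolN; exists 0%N; exact: N0.
have solM : lie_solvable M.
  by apply: NNPP => nsolM; case/negP: nNM; apply: minN.
have [||| v [vN vM Hv]] :=
    lie_theorem_mod charF0 (rho := ad_rep L) (lie_prodv_closed MM) solM (U := N) (W := M).
- by move=> x y xM; apply: NN; apply: (subvP MN).
- by move=> x y xM; apply: MM.
- exact: nNM.
exists M, v; split=> //; apply/eqP; rewrite eqEsubv subv_add MN -memvE vN /=.
apply/negPn/negP => nN; case/negP: (vM).
have/subvP -> // : (M + <[v]> <= M)%VS; last by rewrite (subvP (addvSr _ _)) ?memv_line.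
apply: maxM; last exact: addvSl.
split=> //; last by rewrite subv_add MN -memvE.
have vMod x : x \in M -> [l x, v] \in (M + <[v]>)%VS.
  by move=> /Hv[c Hc]; apply/memv_addlineP; exists c.
move=> _ _ /memv_addP[x xM [_ /vlineP[c ->] ->]] /memv_addP[y yM [_ /vlineP[d ->] ->]].
have xyM := MM _ _ xM yM.
rewrite !(lieDl, lieDr, lieZl, lieZr) liexx !scaler0 addr0 (lieC v).
by rewrite !memvD ?memvZ ?memvN ?vMod // (subvP (addvSl _ _)).
Qed.

Lemma nonsolvable_sl2_mod (U : {vspace L}) : lie_closed U -> ~ lie_solvable U ->
  exists N I e h f, [/\ (N <= U)%VS /\ (I <= N)%VS, lie_solvable I,
    (forall x y, x \in N -> y \in I -> [l x, y] \in I),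
    [/\ e \in N, h \in N, f \in N & e \notin I] /\
    [/\ [l e, f] = h, [l h, e] - 2%:R *: e \in I & [l h, f] + 2%:R *: f \in I]
    & \dim N = (\dim I).+3].
Proof.
move=> UU nsolU.
have [|N [[NN nsolN] NU minN]] :=
  @minimal_vspace _ _ (fun N : {vspace L} => lie_closed N /\ ~ lie_solvable N) U.
  by [].
have [|M [v [MM solM def_N vM]]] := minimal_nonsolvable_codim1 NN nsolN.
  by move=> T TT nsolT TN; apply: minN.
have [I [e [h [f [[IM IN] memN rel dimN]]]]] :=
  sl2_triple_mod_ideal charF0 NN MM def_N vM solM nsolN.
exists N, I, e, h, f; split=> //; last exact: lie_solvableS IM solM.
by split=> //; rewrite -def_N; apply: subv_trans IM (addvSl _ _).
Qed.

Lemma lie_solvable_dim2 (U : {vspace L}) :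
  lie_closed U -> (\dim U <= 2)%N -> lie_solvable U.
Proof.
move=> UU dimU; apply: NNPP => nsolU.
have [N [I [e [h [f [[NU _] _ _ _ dimN]]]]]] := nonsolvable_sl2_mod UU nsolU.
by have := dimvS NU; lia.
Qed.

(** On I, of dimension at most one, e and f act by scalars, so h = [e, f] acts by 0; then e and f,
    being multiples of [h, e] and [h, f] modulo I, also kill I. Corrections inside I therefore leave
    all brackets of the triple unchanged. *)
Lemma sl2_triple_lift (I : {vspace L}) (e h f : L) : (\dim I <= 1)%N ->
  (forall y, y \in I -> [l e, y] \in I) -> (forall y, y \in I -> [l f, y] \in I) ->
  [l e, f] = h -> [l h, e] - 2%:R *: e \in I -> [l h, f] + 2%:R *: f \in I ->
  e \notin I ->
  exists e' h' f' : L, sl2_triple e' h' f' /\ e' != 0.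
Proof.
move=> dimI eI fI ef he hf e_notI.
have two0 : 2%:R != 0 :> F := natr_neq0 charF0 1.
have scal (T : L -> L) : (forall y, y \in I -> T y \in I) ->
    (forall a y, T (a *: y) = a *: T y) -> exists c, forall y, y \in I -> T y = c *: y.
  move=> TI TZ; have [I0|I0] := eqVneq I 0%VS.
    exists 0 => y yI; have := TI y yI; move: yI.
    by rewrite I0 !memv0 scale0r => _ /eqP.
  pose z := vpick I; have z0 : z != 0 by rewrite vpick0.
  have def_I : I = <[z]>%VS.
    by apply/esym/eqP; rewrite eqEdim -memvE memv_pick dim_vline z0.
  have := TI z (memv_pick _); rewrite {1}def_I => /vlineP[c Tz].
  exists c => y; rewrite def_I => /vlineP[a ->]; rewrite TZ Tz !scalerA.
  by rewrite mulrC.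
have [ce He] := scal _ eI (fun a y => lieZr a e y).
have [cf Hf] := scal _ fI (fun a y => lieZr a f y).
have II y z : y \in I -> z \in I -> [l y, z] = 0.
  move=> yI zI; apply/eqP; rewrite -memv0 -(lie_prodv_le1 dimI).
  exact: mem_lie_prodv.
have h0 z : z \in I -> [l h, z] = 0.
  move=> zI; rewrite -ef lie_derivationl (Hf _ zI) (He _ zI) !lieZr He ?Hf //.
  by rewrite !scalerA mulrC subrr.
have x0 (x : L) a : a != 0 -> [l h, x] - a *: x \in I ->
    (forall y, y \in I -> [l x, y] \in I) -> forall z, z \in I -> [l x, z] = 0.
  move=> a0 hx xI z zI; apply/eqP; rewrite -[_ == 0]orFb -(negPf a0) -scaler_eq0.
  have -> : a *: [l x, z] = [l h, [l x, z]] - [l x, [l h, z]] - [l [l h, x] - a *: x, z].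
    by rewrite lieDl lieNl lieZl lie_derivationl; linsep; ring.
  by rewrite (h0 z zI) (h0 _ (xI z zI)) (II _ _ hx zI) lie0r !subr0.
have e0 := x0 e 2%:R two0 he eI.
have f0 z : z \in I -> [l f, z] = 0.
  by apply: (x0 f (- 2%:R)); rewrite ?oppr_eq0 // scaleNr opprK.
(* These differ from e and f by elements of I, and are exact eigenvectors of h because h kills the
   error terms. *)
pose e' := 2%:R^-1 *: [l h, e]; pose f' := - (2%:R^-1 *: [l h, f]).
have he' : [l h, [l h, e]] = 2%:R *: [l h, e].
  have := h0 _ he; rewrite lieDr lieNr lieZr => /eqP.
  by rewrite subr_eq0 => /eqP.
have hf' : [l h, [l h, f]] = - (2%:R *: [l h, f]).
  have := h0 _ hf; rewrite lieDr lieZr => /eqP.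
  by rewrite addr_eq0 => /eqP.
exists e', h, f'; split; first split.
- have -> : e' = e + 2%:R^-1 *: ([l h, e] - 2%:R *: e).
    by rewrite /e'; linsep; field.
  have -> : f' = f - 2%:R^-1 *: ([l h, f] + 2%:R *: f).
    by rewrite /f'; linsep; field.
  rewrite lieDl lieZl !(lieDr _ f) !lieNr !lieZr (e0 _ hf) (II _ _ he hf).
  by rewrite (lieC ([l h, e] - 2%:R *: e) f) (f0 _ he) ef !(scaler0, subr0, oppr0, addr0).
- by rewrite /e' lieZr he' !scalerA mulrC.
- by rewrite /f' lieNr lieZr hf' scalerN opprK !scalerN !scalerA opprK mulrC.
apply: contra e_notI => /eqP e'0.
have -> : e = - (2%:R^-1 *: ([l h, e] - 2%:R *: e)).
  have -> : - (2%:R^-1 *: ([l h, e] - 2%:R *: e)) = e - e'.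
    by rewrite /e'; linsep; field.
  by rewrite e'0 subr0.
by rewrite memvN memvZ.
Qed.

(** If N is all of L, the solvable ideal I is 0 by semisimplicity; otherwise dim N <= 4 and dim I =
    dim N - 3 <= 1. Either way the triple lifts. *)
Lemma semisimple_sl2_triple : lie_semisimple L -> (0 < \dim {:L} <= 5)%N ->
  exists e h f : L, sl2_triple e h f /\ e != 0.
Proof.
move=> ssL /andP[dim0 dim5].
have closedf : lie_closed (fullv : {vspace L}) by move=> *; apply: memvf.
have idealf x y : y \in (fullv : {vspace L}) -> [l x, y] \in (fullv : {vspace L}).
  by rewrite !memvf.
have nsol : ~ lie_solvable (fullv : {vspace L}).
  move=> sol; have /= V0 := ssL (LieIdeal idealf) sol.
  by rewrite V0 dimv0 in dim0.
have [N [I [e [h [f [[_ IN] solI NI [[eN hN fN eI] [ef he hf]] dimN]]]]]] :=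
  nonsolvable_sl2_mod closedf nsol.
apply: (@sl2_triple_lift I e h f) => // [|y|y]; try exact: NI.
have [def_N|nN] := eqVneq N fullv.
  have I_ideal x y : y \in I -> [l x, y] \in I by apply: NI; rewrite def_N memvf.
  have /= -> := ssL (LieIdeal I_ideal) solI.
  by rewrite dimv0.
have : (\dim N < \dim {:L})%N.
  rewrite ltn_neqAle dimvS ?subvf // andbT (dimv_leqif_sup (subvf N)).
  by apply: contra nN => sub; rewrite eqEsubv subvf.
by rewrite dimN; lia.
Qed.

(** * The adjoint action of an sl2-triple in dimension at most five *)

Section SpanTriple.
Variables (e h f : L) (tr : sl2_triple e h f) (e0 : e != 0).

Let S : {vspace L} := (<[h]> + <[e]> + <[f]>)%VS.

Let two0 : 2%:R != 0 :> F := natr_neq0 charF0 1.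

Let ef : [l e, f] = h. Proof. by case: tr. Qed.
Let he : [l h, e] = 2%:R *: e. Proof. by case: tr. Qed.
Let hf : [l h, f] = - (2%:R *: f). Proof. by case: tr. Qed.

Let S_P x : reflect (exists a b c, x = a *: h + b *: e + c *: f) (x \in S).
Proof.
apply: (iffP idP) => [|[a [b [c ->]]]]; last by rewrite !memv_add ?memvZ ?memv_line.
move=> /memv_addP[_ /memv_addP[_ /vlineP[a ->] [_ /vlineP[b ->] ->]] [_ /vlineP[c ->] ->]].
by exists a, b, c.
Qed.

Let hS : h \in S. Proof. by apply/S_P; exists 1, 0, 0; rewrite scale1r !scale0r !addr0. Qed.
Let eS : e \in S. Proof. by apply/S_P; exists 0, 1, 0; rewrite scale1r !scale0r add0r addr0. Qed.
Let fS : f \in S. Proof. by apply/S_P; exists 0, 0, 1; rewrite scale1r !scale0r !add0r. Qed.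

Let SS : lie_closed S.
Proof.
move=> x y /S_P[a [b [c ->]]] /S_P[a' [b' [c' ->]]].
rewrite !(lieDl, lieDr, lieZl, lieZr) !liexx (lieC e h) (lieC f h) (lieC f e) ef he hf.
by rewrite !(memvD, memvN, memvZ, mem0v).
Qed.

Let hw (x : L) a : [l h, x] = a *: x -> forall W : {vspace L}, [l h, x] - a *: x \in W.
Proof. by move=> -> W; rewrite subrr mem0v. Qed.

Let h0 : h != 0.
Proof.
apply: contraNneq e0 => h0; move: he; rewrite h0 lie0l => /esym/eqP.
by rewrite scaler_eq0 (negPf two0).
Qed.

Let f0 : f != 0.
Proof. by apply: contraNneq h0 => f0; rewrite -ef f0 lie0r. Qed.

Let weight_notin_h (x : L) (a : F) :
  x != 0 -> a != 0 -> [l h, x] = a *: x -> x \notin <[h]>%VS.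
Proof.
move=> x0 a0 hx; apply/negP => /vlineP[c def_x]; case/negP: x0.
move: hx; rewrite {1}def_x lieZr liexx scaler0 => /esym/eqP.
by rewrite scaler_eq0 (negPf a0).
Qed.

Let hline w : w \in <[h]>%VS -> ad_rep L h w \in <[h]>%VS.
Proof. by move=> /vlineP[c ->] /=; rewrite lieZr liexx scaler0 mem0v. Qed.

Let hf' : [l h, f] = (- 2%:R) *: f. Proof. by rewrite hf scaleNr. Qed.

Let dimS : \dim S = 3%N.
Proof.
have H := @dim_flag _ _ <[h]>%VS (ad_rep L h) (nth 0 [:: e; f])
  (nth 0 [:: 2%:R; - 2%:R]) hline _ 2.
rewrite -[S]/(flag <[h]> (nth 0 [:: e; f]) 2) H ?dim_vline ?h0 //.
- by case=> [|[|i]] /=; apply: hw; rewrite ?nth_nil ?lie0r ?scaler0.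
- move=> j k jk; have [-> ->] /= : j = 0%N /\ k = 1%N by lia.
  rewrite -subr_eq0 opprK.
  by rewrite -natrD natr_neq0.
- case=> [|[|//]] _ /=; first exact: weight_notin_h he.
  by apply: weight_notin_h hf'; rewrite // oppr_eq0.
Qed.

Lemma span_triple_free a b c : a *: h + b *: e + c *: f = 0 ->
  [/\ a = 0, b = 0 & c = 0].
Proof.
move=> E; have fr : free [tuple h; e; f].
  rewrite /free /= !span_cons span_nil addv0 addvA -[X in \dim X]/S dimS.
  by [].
have /freeP/(_ (fun i : 'I_3 => nth 0 [:: a; b; c] i)) H := fr.
have H' : \sum_(i < 3) nth 0 [:: a; b; c] i *: [tuple h; e; f]`_i = 0.
  by rewrite !big_ord_recl big_ord0 /= addr0 addrA.
by split; [exact: (H H' 0) | exact: (H H' 1) | exact: (H H' ord_max)].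
Qed.

(** Derivations of sl2 are inner. Multiples of e and f reduce [h, v] to a multiple of h, the
    relations force that to vanish and [e, v] to be a multiple of e, and a multiple of h removes the
    latter. *)
Let inner_derivation v : [l e, v] \in S -> [l h, v] \in S -> [l f, v] \in S ->
  exists2 s, s \in S & [/\ [l e, v - s] = 0, [l h, v - s] = 0 & [l f, v - s] = 0].
Proof.
move=> evS hvS fvS; have [b [a [c hv]]] := S_P _ hvS.
have [v1 def_v1] : exists v1, v1 = v - ((a / 2%:R) *: e - (c / 2%:R) *: f).
  by eexists.
have hv1 : [l h, v1] = b *: h.
  rewrite def_v1 !(lieDr, lieNr, lieZr) hv he hf.
  by linsep; field.
have ev1S : [l e, v1] \in S.
  by rewrite def_v1 lieDr lieNr memvB // SS // memvB ?memvZ.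
have [y [x [z ev1]]] := S_P _ ev1S.
have [y0 b0 z0] : [/\ 2%:R * y = 0, - 2%:R * b = 0 & 4%:R * z = 0].
  apply: span_triple_free.
  have := lie_derivation h e v1; rewrite hv1 lieZr he lieZl ev1 (lieC e h) he.
  rewrite !(lieDr, lieNr, lieZr) liexx he hf => E.
  move/eqP: E; rewrite -subr_eq0 -oppr_eq0 => /eqP E.
  by apply: etrans E; linsep; ring.
have {}y0 : y = 0 by apply/eqP; move/eqP: y0; rewrite mulf_eq0 (negPf two0).
have {}b0 : b = 0 by apply/eqP; move/eqP: b0; rewrite mulf_eq0 oppr_eq0 (negPf two0).
have {}z0 : z = 0.
  by apply/eqP; move/eqP: z0; rewrite mulf_eq0 (negPf (natr_neq0 charF0 3)).
rewrite {}y0 {}z0 !scale0r add0r addr0 in ev1; rewrite {}b0 scale0r in hv1.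
have [v2 def_v2] : exists v2, v2 = v1 + (x / 2%:R) *: h by eexists.
have hv2 : [l h, v2] = 0 by rewrite def_v2 lieDr lieZr liexx scaler0 addr0.
have ev2 : [l e, v2] = 0.
  by rewrite def_v2 lieDr lieZr (lieC e h) he ev1; linsep; field.
have fv2S : [l f, v2] \in S.
  rewrite def_v2 def_v1 !(lieDr, lieNr, lieZr) liexx (lieC f e) (lieC f h) ef hf.
  by rewrite !(memvD, memvN, memvZ, mem0v).
have [y' [x' [z' fv2]]] := S_P _ fv2S.
have [y0 x0 _] : [/\ 2%:R * y' = 0, 4%:R * x' = 0 & 0 = 0 :> F].
  apply: span_triple_free.
  have := lie_derivation h f v2; rewrite hv2 lie0r addr0 hf lieNl lieZl fv2.
  rewrite !(lieDr, lieNr, lieZr) liexx he hf => E.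
  move/eqP: E; rewrite -subr_eq0 => /eqP E.
  by apply: etrans E; linsep; ring.
have {}y0 : y' = 0 by apply/eqP; move/eqP: y0; rewrite mulf_eq0 (negPf two0).
have {}x0 : x' = 0.
  by apply/eqP; move/eqP: x0; rewrite mulf_eq0 (negPf (natr_neq0 charF0 3)).
rewrite {}y0 {}x0 !scale0r !add0r in fv2.
have z0 : z' = 0.
  have := lie_derivationl e f v2; rewrite ef hv2 ev2 lie0r subr0 fv2 lieZr ef.
  by move/esym/eqP; rewrite scaler_eq0 (negPf h0) orbF => /eqP.
rewrite {}z0 scale0r in fv2.
exists (((a / 2%:R) *: e - (c / 2%:R) *: f) - (x / 2%:R) *: h).
  by rewrite !memvB ?memvZ.
rewrite (_ : v - _ = v2) //.
by rewrite def_v2 def_v1; linsep; ring.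
Qed.

Let ad_eW : forall w, w \in S -> ad_rep L e w \in S.
Proof. by move=> w; apply: SS. Qed.
Let ad_hW : forall w, w \in S -> ad_rep L h w \in S.
Proof. by move=> w; apply: SS. Qed.
Let ad_fW : forall w, w \in S -> ad_rep L f w \in S.
Proof. by move=> w; apply: SS. Qed.

Hypothesis ssL : lie_semisimple L.
Hypothesis dimL : (\dim {:L} <= 5)%N.

(* If V(1) occurs in L / S, its weight vectors lift to p, q spanning an        *)
(* abelian ideal of L.                                                         *)
Let no_weight1 v : v \notin S -> [l h, v] - v \in S -> [l e, v] \in S -> False.
Proof.
move=> vS hv ev; have [b [a [c def_w]]] := S_P _ hv.
have three0 : 3%:R != 0 :> F := natr_neq0 charF0 2.
(* With [h, v] = v + b h + a e + c f, these coefficients solve [h, p] = p exactly. *)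
pose p := v + (b *: h - a *: e + (c / 3%:R) *: f).
have hp : [l h, p] = p.
  have hv' : [l h, v] = v + (b *: h + a *: e + c *: f) by rewrite -def_w addrC subrK.
  by rewrite /p !(lieDr, lieNr, lieZr) liexx he hf hv'; linsep; field.
have sS : b *: h - a *: e + (c / 3%:R) *: f \in S by rewrite memvD ?memvB ?memvZ.
have pS : p \notin S.
  apply: contra vS => pS.
  by rewrite -(addrK (b *: h - a *: e + (c / 3%:R) *: f) v) memvB.
have epS : [l e, p] \in S by rewrite lieDr memvD // SS.
clearbody p; pose q := [l f, p].
have hp1 : ad_rep L h p - 1 *: p \in S by rewrite scale1r /= hp subrr mem0v.
have [n [n1 _ _ dimfl]] :=
  sl2_string charF0 tr ad_eW ad_hW ad_fW pS hp1 (epS : ad_rep L e p \in S).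
have {n1} n1 : n = 1%N by apply/esym/(natr_inj charF0).
rewrite {}n1 dimS in dimfl.
pose vs := nth 0 [:: e; f; p; q]; pose ws : nat -> F := nth 0 [:: 2%:R; -2%:R; 1; -1].
(* S has dimension 3 and the string p, q adds 2, so h, e, f, p, q already span L, with weights 0, 2,
   -2, 1, -1. *)
have full : flag <[h]> vs 4 = fullv.
  have E4 : flag S (f_orbit f (ad_rep L) p) 2 = flag <[h]> vs 4 by [].
  by apply/eqP; rewrite eqEdim subvf -E4 dimfl.
have hq : [l h, q] = - q.
  by rewrite lie_derivation hf hp lieNl lieZl -/q; linsep; ring.
have hvs i : ad_rep L h (vs i) - ws i *: vs i \in <[h]>%VS.
  apply: hw; rewrite /vs /ws; case: i => [|[|[|[|i]]]] //=; rewrite ?scale1r ?scaleN1r //.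
  by rewrite nth_nil scaler0 lie0r.
have weight mu y : (forall j, (j < 4)%N -> mu != ws j) ->
    [l h, y] = mu *: y -> y \in <[h]>%VS.
  move=> mu_ws hy; have yF : y \in flag <[h]> vs 4 by rewrite full memvf.
  exact: (@flag_weight_mod _ _ <[h]>%VS (ad_rep L h) vs ws hline hvs 4 y mu
    mu_ws yF (hw hy _)).
have weight0 mu y : mu != 0 -> (forall j, (j < 4)%N -> mu != ws j) ->
    [l h, y] = mu *: y -> y = 0.
  move=> mu0 mu_ws hy; apply/eqP/negPn/negP => y0.
  by case/negP: (weight_notin_h y0 mu0 hy); apply: weight mu_ws hy.
have natN (i j : nat) : (0 < i + j)%N -> i%:R != - j%:R :> F.
  by rewrite -subr_eq0 opprK -natrD => /prednK <-; apply: natr_neq0.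
have natE (i j : nat) : i != j -> i%:R != j%:R :> F.
  by rewrite (inj_eq (natr_inj charF0)).
(* This bracket would have weight 3, which does not occur; likewise [f, q] would have weight -3. *)
have ep : [l e, p] = 0.
  apply: (weight0 3%:R) => // [[|[|[|[|//]]]] _ /=|].
  - exact: natE.
  - exact: natN.
  - exact: (natE 3 1).
  - exact: (natN 3 1).
  - by rewrite lie_derivation he hp lieZl; linsep; ring.
have eq : [l e, q] = p.
  by rewrite lie_derivation ep lie0r addr0 ef hp.
have fq : [l f, q] = 0.
  apply: (weight0 (- 3%:R)) => // [|[|[|[|[|//]]]] _ /=|].
  - by rewrite oppr_eq0.
  - by rewrite eq_sym natN.
  - by rewrite eqr_opp natE.
  - by rewrite eq_sym (natN 1 3).
  - by rewrite eqr_opp (natE 3 1).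
  - by rewrite lie_derivation hf hq lieNl lieZl lieNr; linsep; ring.
(* Of weight 0, hence d h; bracketing with e gives [p, p] = 0 on one side and - 2 d e on the
   other. *)
have pq : [l p, q] = 0.
  have : [l p, q] \in <[h]>%VS.
    apply: (weight 0) => [[|[|[|[|//]]]] _ /=|].
    - exact: (natE 0 2).
    - exact: (natN 0 2).
    - exact: (natE 0 1).
    - exact: (natN 0 1).
    - by rewrite lie_derivation hp hq lieNr scale0r subrr.
  move=> /vlineP[d pq]; have := lie_derivation e p q.
  rewrite ep eq lie0l liexx addr0 pq lieZr (lieC e h) he scalerN scalerA => /eqP.
  rewrite oppr_eq0 scaler_eq0 mulf_eq0 (negPf e0) (negPf two0) !orbF => /eqP->.
  by rewrite scale0r.
have fp : [l f, p] = q by [].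
clearbody q; pose A : {vspace L} := (<[p]> + <[q]>)%VS.
have pA : p \in A by rewrite (subvP (addvSl _ _)) ?memv_line.
have qA : q \in A by rewrite (subvP (addvSr _ _)) ?memv_line.
have AA x y : x \in A -> y \in A -> [l x, y] = 0.
  move=> /memv_addP[_ /vlineP[b1 ->] [_ /vlineP[b2 ->] ->]].
  move=> /memv_addP[_ /vlineP[c1 ->] [_ /vlineP[c2 ->] ->]].
  by rewrite !(lieDl, lieDr, lieZl, lieZr) !liexx (lieC q p) pq oppr0 !(scaler0, addr0).
have A_ideal x y : y \in A -> [l x, y] \in A.
  have [T HT] := @vspace_of_pred _ _ (fun x => forall y, y \in A -> [l x, y] \in A)
    (fun y _ => eq_ind_r (fun z => z \in A) (mem0v A) (lie0l y))
    (fun a x1 x2 H1 H2 y yA => eq_ind_r (fun z => z \in A)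
       (memvD (memvZ a (H1 y yA)) (H2 y yA)) (ad_linearl y a x1 x2)).
  suff /HT: x \in T by apply.
  apply: (subvP _ x (memvf x)); rewrite -full.
  have gen (z : L) : [l z, p] \in A -> [l z, q] \in A -> z \in T.
    move=> zp zq; apply/HT => _ /memv_addP[_ /vlineP[b1 ->] [_ /vlineP[b2 ->] ->]].
    by rewrite lieDr !lieZr memvD ?memvZ.
  apply: flag_sub => [|[|[|[|[|//]]]] _ /=].
  - by rewrite -memvE gen ?hp ?hq ?memvN.
  - by rewrite gen ?ep ?eq ?mem0v.
  - by rewrite gen ?fp ?fq ?mem0v.
  - by rewrite gen ?liexx ?pq ?mem0v.
  - by rewrite gen ?liexx ?(lieC q p) ?pq ?oppr0 ?mem0v.
have A0 : A = 0%VS := ssL (I := LieIdeal A_ideal) (lie_abelian_solvable AA).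
by move: pA; rewrite A0 memv0 => /eqP p0; rewrite p0 mem0v in pS.
Qed.

(** Let C be the centraliser of S. If S + C were proper, a highest weight vector modulo it would
    have weight n with 3 + n + 1 <= 5, so n is 0 or 1, and both are impossible. Hence L = S + C, and
    C is an ideal of dimension at most two, so solvable, so 0. *)
Lemma span_triple_full : S = fullv.
Proof.
have [|a x y [Hx1 Hx2 Hx3] [Hy1 Hy2 Hy3]|C HC] :=
  @vspace_of_pred _ _ (fun x => [/\ [l e, x] = 0, [l h, x] = 0 & [l f, x] = 0]).
- by rewrite !lie0r.
- by rewrite !lieDr !lieZr Hx1 Hx2 Hx3 Hy1 Hy2 Hy3 !scaler0 !addr0.
pose T : {vspace L} := (S + C)%VS.
have ST : (S <= T)%VS by exact: addvSl.
have comm x c : x \in S -> c \in C -> [l x, c] = 0.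
  move=> /S_P[a1 [a2 [a3 ->]]] /HC[H1 H2 H3].
  by rewrite !lieDl !lieZl H1 H2 H3 !scaler0 !addr0.
have ST_S x t : x \in S -> t \in T -> [l x, t] \in S.
  by move=> xS /memv_addP[y yS [c cC ->]]; rewrite lieDr (comm x c) // addr0 SS.
have Tfull : T = fullv.
  apply/eqP; rewrite eqEsubv subvf /=; apply/negPn/negP => nT.
  have stT x w : x \in S -> w \in T -> ad_rep L x w \in T.
    by move=> xS wT; apply: (subvP ST); apply: ST_S.
  have [|| v [c [_ vT hv ev]]] :=
      borel_eigenvector charF0 tr (fun w => stT e w eS) (fun w => stT h w hS)
        (U := fullv) _ _ nT.
  - by move=> *; rewrite memvf.
  - by move=> *; rewrite memvf.
  have [n [def_c fn _ dimfl]] := sl2_string charF0 tr (fun w => stT e w eS)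
    (fun w => stT h w hS) (fun w => stT f w fS) vT hv ev.
  have le3 := dimvS ST; rewrite dimS in le3.
  have := dimvS (subvf (flag T (f_orbit f (ad_rep L) v) n.+1)); rewrite dimfl => dimT.
  case: n {dimfl} def_c fn dimT => [|[|n]] def_c fn dimT;
    last by have := leq_trans (leq_trans (leq_add le3 (leqnn n.+3)) dimT) dimL.
    (* Weight 0: e, h and f send v into T and [S, T] lies in S, so writing each of them as a
       commutator puts its bracket with v into S. Thus v induces a derivation of S, inner, and v
       lies in S + C. *)
    rewrite def_c scale0r subr0 /= in hv; rewrite /= in fn ev.
    have hv' : [l h, v] \in S.
      rewrite -ef lie_derivationl memvB ?ST_S //.
    have ev' : [l e, v] \in S.
      apply: (scale_mem two0); rewrite -lieZl -he lie_derivationl memvB ?ST_S //.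
    have fv' : [l f, v] \in S.
      apply: (scale_mem two0); rewrite -memvN -scalerN -lieNl -lieZl scalerN -hf.
      by rewrite lie_derivationl memvB ?ST_S.
    have [s sS sC] := inner_derivation ev' hv' fv'.
    case/negP: vT; rewrite -(subrK s v) addrC memv_add //; exact/HC.
  (* Weight 1: the string takes two dimensions, leaving dim T = 3. *)
  have TS : T = S by apply/esym/eqP; rewrite eqEdim ST dimS -(leq_add2r 2) (leq_trans dimT).
  by apply: (@no_weight1 v); rewrite -?TS //= -[X in _ - X]scale1r -[1]/(1%:R) -def_c.
have C_ideal x y : y \in C -> [l x, y] \in C.
  have := memvf x; rewrite -Tfull => /memv_addP[s sS [c cC ->]] yC.
  have /HC[ey hy fy] := yC; have /HC[ec hc fc] := cC.
  rewrite lieDl (comm s y) // add0r; apply/HC.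
  rewrite (lie_derivation e) (lie_derivation h) (lie_derivation f).
  by rewrite ec hc fc ey hy fy !lie0l !lie0r !addr0.
have SC0 : (S :&: C = 0)%VS.
  apply/eqP; rewrite -subv0; apply/subvP => y.
  case/memv_capP=> /S_P[a [b [c ->]]] /HC[Hx1 Hx2 _].
  have [_ b0 c0] : [/\ 0 = 0 :> F, 2%:R * b = 0 & - 2%:R * c = 0].
    apply: span_triple_free.
    move: Hx2; rewrite !(lieDr, lieZr) liexx he hf => E.
    by apply: etrans E; linsep; ring.
  have [_ a0 _] : [/\ c = 0, - 2%:R * a = 0 & 0 = 0 :> F].
    apply: span_triple_free.
    move: Hx1; rewrite !(lieDr, lieZr) liexx (lieC e h) he ef => E.
    by apply: etrans E; linsep; ring.
  move: a0 b0 c0 => /eqP; rewrite mulf_eq0 oppr_eq0 (negPf two0) => /eqP->.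
  move=> /eqP; rewrite mulf_eq0 (negPf two0) => /eqP->.
  move=> /eqP; rewrite mulf_eq0 oppr_eq0 (negPf two0) => /eqP->.
  by rewrite !scale0r !addr0 mem0v.
have solC : lie_solvable C.
  apply: lie_solvable_dim2 => [x y _|]; first exact: C_ideal.
  by have := dimv_disjoint_sum SC0; rewrite -/T Tfull dimS; lia.
have C0 : C = 0%VS := ssL (I := LieIdeal C_ideal) solC.
by rewrite -Tfull /T C0 addv0.
Qed.

Lemma sl2_iso_of_triple :
  exists2 phi : lieHom (sl F 2) L, bijective phi & \dim {:L} = 3%N.
Proof.
have Sfull := span_triple_full.
pose g (A : sl F 2) := vsval A 0 0 *: h + vsval A 0 1 *: e + vsval A 1 0 *: f.
have g_lin : linear g.
  move=> a A B; have entry i j : vsval (a *: A + B) i j = a * vsval A i j + vsval B i j.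
    by rewrite linearP !mxE.
  rewrite /g !entry.
  move: (vsval A 0 0) (vsval A 0 1) (vsval A 1 0) => b c d.
  move: (vsval B 0 0) (vsval B 0 1) (vsval B 1 0) => b' c' d'.
  by linsep; ring.
pose gL : {linear sl F 2 -> L} := HB.pack g (GRing.isLinear.Build F _ _ _ g g_lin).
have GE A : linfun gL A = g A by rewrite lfunE.
have GE' a b c : linfun gL (sl2_elt a b c) = a *: h + b *: e + c *: f.
  by rewrite GE /g !sl2_eltE.
have G_lie A B : linfun gL [l A, B] = [l linfun gL A, linfun gL B].
  rewrite -[A]sl2_eltK -[B]sl2_eltK.
  move: (vsval A 0 0) (vsval A 0 1) (vsval A 1 0) => a b c.
  move: (vsval B 0 0) (vsval B 0 1) (vsval B 1 0) => a' b' c'.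
  rewrite sl2_lie !GE' !(lieDl, lieDr, lieZl, lieZr) !liexx.
  rewrite (lieC e h) (lieC f h) (lieC f e) ef he hf.
  by linsep; ring.
exists (LieHom G_lie); last by rewrite -Sfull dimS.
have inj : injective (linfun gL).
  apply/lker0P; rewrite -subv0; apply/subvP => A; rewrite memv_ker GE memv0 => /eqP.
  case/span_triple_free => a0 b0 c0; apply/eqP/sl_eqP; rewrite ?linear0 ?mxE //.
have surj x : x \in limg (linfun gL).
  have := memvf x; rewrite -Sfull => /S_P[a [b [c ->]]].
  apply/memv_imgP; exists (sl2_elt a b c); rewrite ?memvf // GE'.
exists (linfun gL)^-1%VF => x /=; last by rewrite limg_lfunVK.
by apply: inj; rewrite limg_lfunVK.
Qed.

End SpanTriple.

Theorem small_semisimple_sl2 : lie_semisimple L -> (0 < \dim {:L} <= 5)%N ->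
  exists2 phi : lieHom (sl F 2) L, bijective phi & \dim {:L} = 3%N.
Proof.
move=> ssL dimL; have [e [h [f [tr e0]]]] := semisimple_sl2_triple ssL dimL.
by case/andP: dimL => _ dim5; apply: sl2_iso_of_triple tr e0 ssL dim5.
Qed.

End SmallSemisimple.

(** * Quadratic Lie algebras *)

Section QuadraticAlgebra.
Variables (F : fieldType) (g : lieAlgType F) (B : quadForm g).

Lemma quad_sym x y : B x y = B y x.
Proof. by rewrite hermC /= expr0 mul1r. Qed.

Lemma quad_nondegP x : (forall y, B x y = 0) -> x = 0.
Proof.
move=> H; apply/eqP; rewrite -memv0 -(eqP (quad_nondeg B)).
by apply/mem_orthovP => y _.
Qed.

Lemma quad_invN x y z : B [l x, y] z = - B y [l x, z].
Proof. by rewrite lieC linearNl /= quad_inv. Qed.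

Lemma quadDl x y z : B (x + y) z = B x z + B y z. Proof. exact: linearDl. Qed.
Lemma quadBl x y z : B (x - y) z = B x z - B y z. Proof. exact: linearBl. Qed.
Lemma quadZl a x z : B (a *: x) z = a * B x z. Proof. exact: linearZl_LR. Qed.

Lemma dim_cap_orthov (V W : {vspace g}) :
  (\dim V <= \dim (V :&: orthov B W) + \dim W)%N.
Proof.
suff H X : (\dim V <= \dim (V :&: orthov B <<X>>) + size X)%N.
  by have := H (vbasis W); rewrite size_tuple (span_basis (vbasisP W)).
elim: X => [|x X IH] /=; first by rewrite span_nil orthov0 capvf addn0.
have -> : orthov B <<x :: X>> = (orthov B <<X>> :&: orthov B <[x]>)%VS.
  apply/vspaceP => y; rewrite memv_cap span_cons.
  apply/mem_orthovP/andP => [H|[/mem_orthovP H1 /mem_orthovP H2] z].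
    split; apply/mem_orthovP => z zX; apply: H.
      exact: (subvP (addvSr _ _)).
    exact: (subvP (addvSl _ _)).
  move=> /memv_addP[z1 z1x [z2 z2X ->]].
  by rewrite linearDr /= H2 // H1 // addr0.
have := leq_dim_orthov1 B x (V :&: orthov B <<X>>)%VS; rewrite capvA => H.
by apply: (leq_trans IH); rewrite addnS -addSn leq_add2r; move: H; case: (\dim (V :&: _)).
Qed.

(** For the upper bound, a vector of U orthogonal to a complement of U^perp is orthogonal to
    everything, hence 0 by nondegeneracy. *)
Lemma dim_orthov (U : {vspace g}) :
  (\dim (orthov B U) + \dim U)%N = \dim {:g}.
Proof.
apply/eqP; rewrite eqn_leq; apply/andP; split; last first.
  by have := dim_cap_orthov fullv U; rewrite capfv.
have := dim_cap_orthov U (orthov B U)^C%VS.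
suff -> : (U :&: orthov B (orthov B U)^C = 0)%VS.
  by rewrite dimv0 add0n dimv_compl; have := dimvS (subvf (orthov B U)); lia.
apply/eqP; rewrite -subv0; apply/subvP => x /memv_capP[xU /mem_orthovP xC].
rewrite memv0; apply/eqP/quad_nondegP => y.
have := memvf y; rewrite -(addv_complf (orthov B U)) .
case/memv_addP=> y1 /mem_orthovP y1U [y2 y2C ->].
by rewrite linearDr /= (xC y2 y2C) addr0 quad_sym y1U.
Qed.

Lemma lieIdealPl (I : lieIdeal g) x y : x \in I -> [l x, y] \in I.
Proof. by move=> xI; rewrite lie_memC; apply: lieIdealP. Qed.

Lemma orth_ideal_comm (I : lieIdeal g) x y :
  x \in I -> y \in orth_ideal B I -> [l y, x] = 0.
Proof.
move=> xI /mem_orthovP yI; apply: quad_nondegP => z.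
by rewrite quad_inv yI // lieIdealPl.
Qed.

Lemma derived_ideal (I : lieIdeal g) n x y :
  y \in derived_series I n -> [l x, y] \in derived_series I n.
Proof.
elim: n y => [|n IH] y; first exact: lieIdealP.
rewrite /= -/(derived_series I n) => yI.
rewrite -[[l x, y]](lfunE (ad_rep g x)) memv_preim; apply: (subvP _ _ yI).
apply/lie_prodvP => u v uI vI; rewrite -memv_preim lfunE /= lie_derivation.
by rewrite memvD ?mem_lie_prodv ?IH.
Qed.

Lemma derived_ideal_sub (I : lieIdeal g) n : (derived_series I n <= I)%VS.
Proof.
elim: n => //= n /subvP IH; apply/lie_prodvP => u v _ vI.
exact: lieIdealP (IH _ vI).
Qed.

Section Radical.
Variable r : lieIdeal g.
Hypothesis r_radical : is_radical r.

(* I /\ I^perp is an abelian ideal. *)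
Lemma cap_orth_radical (I : lieIdeal g) : (I :&: orth_ideal B I <= r)%VS.
Proof.
have A_ideal x y : y \in (I :&: orth_ideal B I)%VS ->
    [l x, y] \in (I :&: orth_ideal B I)%VS.
  by case/memv_capP => yI yJ; rewrite memv_cap !lieIdealP.
have [_ /(_ (LieIdeal A_ideal))] := r_radical; apply; apply: lie_abelian_solvable => x y.
by move=> /memv_capP[_ xJ] /memv_capP[yI _]; apply: orth_ideal_comm yI xJ.
Qed.

(** The kernel of the form restricted to I is I /\ I^perp, which lies in r; if I meets r trivially
    the restriction is nondegenerate and irreducibility applies. *)
Lemma irreducible_ideal (I : lieIdeal g) : irreducible_quadratic B ->
  (I :&: r = 0)%VS -> (I : {vspace g}) = 0%VS \/ (I : {vspace g}) = fullv.
Proof.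
move=> irr Ir; have [I0|I0] := eqVneq (I : {vspace g}) 0%VS; first by left.
have [If|If] := eqVneq (I : {vspace g}) fullv; first by right.
case: (irr I); [exact/eqP | exact/eqP |] => x xI xIo.
apply/eqP; rewrite -memv0 -Ir memv_cap xI (subvP (cap_orth_radical I)) //.
by rewrite memv_cap xI; apply/mem_orthovP.
Qed.

End Radical.
End QuadraticAlgebra.

(** * The Levi factor of an irreducible quadratic algebra *)

Section LeviDecomposition.
Variables (F : closedFieldType) (charF0 : [pchar F] =i pred0).
Variables (g : lieAlgType F) (B : quadForm g) (s : lieSubalg g) (r : lieIdeal g).
Hypothesis r_radical : is_radical r.
Hypothesis s_levi : is_levi s r.
Hypothesis g_nonsolvable : ~ lie_solvable (fullv : {vspace g}).
Hypothesis g_nonsimple : ~ lie_simple g.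
Hypothesis g_irreducible : irreducible_quadratic B.
Hypothesis r_neq_rperp : (r : {vspace g}) <> orth_ideal B r.
Hypothesis dim_g : (\dim {:g} <= 13)%N.

Let J := orth_ideal B r.

Let sr_full : (s + r = fullv)%VS. Proof. by case: s_levi. Qed.
Let sr0 : (s :&: r = 0)%VS. Proof. by case: s_levi. Qed.

Let decomp x : exists2 a, a \in s & exists2 b, b \in r & x = a + b.
Proof.
have := memvf x; rewrite -sr_full => /memv_addP[a ? [b ? ->]].
by exists a => //; exists b.
Qed.

Let dim_sr : (\dim s + \dim r)%N = \dim {:g}.
Proof. by rewrite -sr_full dimv_disjoint_sum. Qed.

Let radical_neq0 : (r : {vspace g}) <> 0%VS.
Proof.
move=> r0; apply: g_nonsimple; split=> [gg|I].
  by apply: g_nonsolvable; exists 1%N.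
by apply: (irreducible_ideal r_radical g_irreducible); rewrite r0 capv0.
Qed.

(* Since r^perp centralises r, the r-component changes sign under brackets in  *)
(* r^perp; as r is solvable, a derived ideal of r^perp lies in s, where the    *)
(* form restricted to it is nondegenerate.                                     *)
Lemma perp_radical_sub : (J <= r)%VS.
Proof.
have [solr maxr] := r_radical; apply: maxr; have [n rn] := solr.
have Jsr k : (derived_series J k <= s + derived_series r k)%VS.
  elim: k => [|k IH]; first by rewrite /= sr_full subvf.
  apply/lie_prodvP => x y xJk yJk.
  have dJ z : z \in derived_series J k -> z \in J by apply/subvP/derived_ideal_sub.
  have dr z : z \in derived_series r k -> z \in r by apply/subvP/derived_ideal_sub.
  have /memv_addP[x1 x1s [x2 x2r def_x]] := subvP IH _ xJk.
  have /memv_addP[y1 y1s [y2 y2r def_y]] := subvP IH _ yJk.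
  have xy2 : [l x, y2] = 0 by apply: orth_ideal_comm (dr _ y2r) (dJ _ xJk).
  have x2y : [l x2, y] = 0.
    by rewrite lieC (orth_ideal_comm (dr _ x2r) (dJ _ yJk)) oppr0.
  have -> : [l x, y] = [l x1, y1] - [l x2, y2].
    move: x2y xy2; rewrite def_x def_y !(lieDl, lieDr) => /eqP.
    rewrite addr_eq0 => /eqP-> /eqP; rewrite addr_eq0 => /eqP->.
    by rewrite addrA; linsep; ring.
  by rewrite memv_add ?lieSubalgP // memvN mem_lie_prodv.
pose P := LieIdeal (@derived_ideal _ _ J n).
have Ps : (P <= s)%VS by have := Jsr n; rewrite rn addv0.
have [|P0|Pf] := irreducible_ideal r_radical (I := P) g_irreducible.
- by apply/eqP; rewrite -subv0 -sr0 capvS.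
- by exists n.
by case: radical_neq0; rewrite -[LHS]capfv; apply/eqP; rewrite -subv0 -sr0 capvS // -Pf.
Qed.

Lemma dim_perp_radical : \dim J = \dim s.
Proof. by apply/eqP; rewrite -(eqn_add2r (\dim r)) dim_orthov dim_sr. Qed.

Let dim_Jr : (\dim J < \dim r)%N.
Proof.
rewrite ltn_neqAle dimvS ?perp_radical_sub // andbT.
rewrite (dimv_leqif_sup perp_radical_sub); apply/negP => rJ; apply: r_neq_rperp.
by apply/eqP; rewrite eqEsubv rJ perp_radical_sub.
Qed.

(* A nonzero z orthogonal to s + r^perp would be central and nonisotropic. *)
Lemma dim_factor_neq1 : \dim r <> (\dim J).+1.
Proof.
move=> dim_r.
have two0 : 2%:R != 0 :> F := natr_neq0 charF0 1.
have dimT := dim_orthov B (s + J)%VS.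
have dim_sJ : (\dim (s + J) <= \dim s + \dim J)%N by exact: dimv_add_leqif.
have T0 : orthov B (s + J)%VS != 0%VS by rewrite -dimv_eq0; lia.
pose z := vpick (orthov B (s + J)).
have z0 : z != 0 by rewrite vpick0.
have /mem_orthovP zsJ : z \in orthov B (s + J) := memv_pick _.
have zs x : x \in s -> B z x = 0 by move=> xs; apply/zsJ/(subvP (addvSl _ _)).
have zJ x : x \in J -> B z x = 0 by move=> xs; apply/zsJ/(subvP (addvSr _ _)).
have perp2 : (orthov B J : {vspace g}) = r.
  apply/esym/eqP; rewrite eqEdim; apply/andP; split; last first.
    have dimJ : (\dim J + \dim r)%N = \dim {:g} := dim_orthov B r.
    by rewrite -(leq_add2r (\dim J)) dim_orthov addnC dimJ.
  by apply/subvP => x xr; apply/mem_orthovP => y /mem_orthovP yJ; rewrite quad_sym yJ.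
have zr : z \in r by rewrite -perp2; apply/mem_orthovP.
have zNJ : z \notin J.
  apply: contra z0 => /mem_orthovP zJ'; apply/eqP/(@quad_nondegP _ _ B) => x.
  by have [a aS [b br ->]] := decomp x; rewrite linearDr /= zs // zJ' // addr0.
have def_r : (J + <[z]>)%VS = r.
  apply/eqP; rewrite eqEdim subv_add perp_radical_sub -memvE zr dim_add_line //.
  by rewrite dim_r /=.
have Bzz : B z z != 0.
  apply: contra zNJ => /eqP Bzz; apply/mem_orthovP => y; rewrite -def_r.
  move=> /memv_addP[y1 y1J [_ /vlineP[c ->] ->]].
  by rewrite linearDr linearZr_LR /= Bzz zJ // mulr0 addr0.
(* Since s, r^perp and z span g, vanishing against these three suffices. *)
have test x : (forall y, y \in s -> B x y = 0) -> (forall y, y \in J -> B x y = 0) ->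
    B x z = 0 -> x = 0.
  move=> xs xJ xz; apply: (@quad_nondegP _ _ B) => y.
  have [a aS [b br ->]] := decomp y; rewrite linearDr /= xs // add0r.
  move: br; rewrite -def_r => /memv_addP[y1 y1J [_ /vlineP[c ->] ->]].
  by rewrite linearDr linearZr_LR /= xz xJ // mulr0 addr0.
have Jz x : x \in J -> [l x, z] = 0 by apply: orth_ideal_comm.
have sz x : x \in s -> [l x, z] = 0.
  move=> xs; apply: test => [y ys|y yJ|].
  - by rewrite quad_invN zs ?oppr0 // lieSubalgP.
  - by rewrite quad_inv lieC Jz // oppr0 linear0r.
  (* ad x is skew for the form, so [x, z] is orthogonal to z. *)
  - have E : B [l x, z] z = - B [l x, z] z by rewrite {1}quad_invN quad_sym.
    move/eqP: E; rewrite -subr_eq0 opprK -mulr2n -mulr_natl mulf_eq0 (negPf two0).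
    by move/eqP.
have zcentral x : [l x, z] = 0.
  have [a aS [b br ->]] := decomp x; rewrite lieDl sz // add0r.
  move: br; rewrite -def_r => /memv_addP[y1 y1J [_ /vlineP[c ->] ->]].
  by rewrite lieDl lieZl liexx scaler0 addr0 Jz.
have Z_ideal x y : y \in <[z]>%VS -> [l x, y] \in <[z]>%VS.
  by move=> /vlineP[c ->]; rewrite lieZr zcentral scaler0 mem0v.
apply: (@g_irreducible (LieIdeal Z_ideal)) => /=.
- by apply/eqP; rewrite -dimv_eq0 dim_vline z0.
- move=> Zf; apply: g_nonsolvable; rewrite -Zf; apply: lie_abelian_solvable => x y _.
  by move=> /vlineP[c ->]; rewrite lieZr zcentral scaler0.
move=> _ /vlineP[c ->] /(_ z (memv_line z)) /eqP.
by rewrite quadZl mulf_eq0 (negPf Bzz) orbF => /eqP->; rewrite scale0r.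
Qed.

(** dim g = 2 dim s + dim (r / r^perp) <= 13, and the last term is neither 0 nor 1, so dim s <=
    5. *)
Lemma levi_sl2 :
  (exists phi : lieHom (sl F 2) (subvs_of s), bijective phi) /\ \dim s = 3%N.
Proof.
have ds : \dim {:subvs_of s} = \dim s by rewrite dimvf.
have ss : lie_semisimple (subvs_of s) by case: s_levi.
have s0 : (0 < \dim s)%N.
  rewrite lt0n dimv_eq0; apply/eqP => s0; apply: g_nonsolvable.
  by move: sr_full; rewrite s0 add0v => <-; case: r_radical.
have := dim_factor_neq1; have := dim_Jr; have := dim_sr; rewrite dim_perp_radical => *.
have [|phi phi_bij dim3] := small_semisimple_sl2 charF0 ss; first by rewrite ds; lia.
by split; [exists phi | rewrite -ds].
Qed.

End LeviDecomposition.

Lemma pull_rep_irreducible (F : fieldType) (L L' : lieAlgType F) (M : vectType F)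
    (rho : lieRep L M) (phi : lieHom L' L) : bijective phi ->
  irreducible_rep rho -> irreducible_rep (pull_rep rho phi).
Proof.
move=> [psi phiK psiK] [M0 irr]; split=> // U.
have stable x m : m \in U -> rho x m \in U.
  by move=> mU; rewrite -(psiK x); apply: (submodP (s := U) (psi x)).
exact: (irr (Submod stable)).
Qed.

(** * Pulling submodules of r / r^perp back to r *)

Section FactorSubmodule.
Variables (F : closedFieldType) (charF0 : [pchar F] =i pred0).
Variables (g : lieAlgType F) (B : quadForm g) (s : lieSubalg g) (r : lieIdeal g).
Let J := orth_ideal B r.
Hypothesis Jr : (J <= r)%VS.
Variable u : submod (factor_rep J s r).

Let ival (p : subvs_of u) : quotv J := vsval (vsval p).

Let ivalP : linear ival.
Proof. by []. Qed.

Let ival_mem p : ival p \in (linfun (quotv_pi J) @: r)%VS.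
Proof. exact: subvsP. Qed.

(** u lives in a subspace type over r / J, itself inside g / J; it is first pushed to g / J and then
    pulled back to g. *)
Definition factor_preimage : {vspace g} :=
  (linfun (quotv_pi J) @^-1:
     (linfun (vsval : subvs_of (factor_submod J r) -> quotv J) @: u))%VS.

Let preimageP y : reflect (exists p, quotv_pi J y = ival p) (y \in factor_preimage).
Proof.
rewrite /factor_preimage -memv_preim lfunE /=.
apply: (iffP memv_imgP) => [[m mu ->]|[p ->]].
  by exists (Subvs mu); rewrite lfunE.
by exists (vsval p); rewrite ?subvsP // lfunE.
Qed.

Lemma factor_preimage_sub : (factor_preimage <= r)%VS.
Proof.
apply/subvP => y /preimageP[p def_y]; have /memv_imgP[z zr] := ival_mem p.
rewrite lfunE /= -def_y => /eqP; rewrite quotv_pi_eq => /(subvP Jr) yz.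
by rewrite -(subrK z y) memvD.
Qed.

Lemma dim_factor_preimage : \dim factor_preimage = (\dim u + \dim J)%N.
Proof.
set Q := (linfun (vsval : subvs_of (factor_submod J r) -> quotv J) @: u)%VS.
have dimQ : \dim Q = \dim u.
  apply: limg_dim_eq; apply/eqP; rewrite -subv0; apply/subvP => m /memv_capP[_].
  by rewrite memv_ker lfunE memv0.
have kerJ : lker (linfun (quotv_pi J)) = J.
  apply/vspaceP => y; rewrite memv_ker lfunE /= -[0](linear0 (quotv_pi J)).
  by rewrite quotv_pi_eq subr0.
rewrite -(limg_ker_dim (linfun (quotv_pi J)) factor_preimage) kerJ addnC.
rewrite lpreimK ?dimQ; last first.
  by apply/subvP => q _; rewrite -(quotv_reprK q) -lfunE memv_img ?memvf.
congr (_ + \dim _)%N; apply/capv_idPr/subvP => y yJ; apply/preimageP.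
exists 0; rewrite /ival !linear0 -[0](linear0 (quotv_pi J)); apply/eqP.
by rewrite quotv_pi_eq subr0.
Qed.

Let rep_pre p : repr (ival p) \in factor_preimage.
Proof. by apply/preimageP; exists p; rewrite quotv_reprK. Qed.

(** J is orthogonal to r, so values of the form on r do not depend on coset representatives modulo
    J. *)
Let form_eq y y' z : y \in factor_preimage -> y' \in factor_preimage -> z \in r ->
  quotv_pi J y = quotv_pi J y' -> B y z = B y' z.
Proof.
move=> yP y'P zr /eqP; rewrite quotv_pi_eq => /mem_orthovP/(_ z zr).
by rewrite quadBl => /eqP; rewrite subr_eq0 => /eqP.
Qed.

Let preimage_r y : y \in factor_preimage -> y \in r.
Proof. exact/subvP/factor_preimage_sub. Qed.

(* The form of g induces an invariant symmetric form on u, which vanishes when *)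
(* u = V(n) with n odd; the preimage of u in r is then totally isotropic.      *)
Lemma odd_factor_isotropic (phi : lieHom (sl F 2) (subvs_of s)) n v : odd n ->
  sl2_standard_basis (pull_rep (sub_rep u) phi) n v ->
  (factor_preimage <= orthov B factor_preimage)%VS.
Proof.
move=> n_odd std; pose b (p q : subvs_of u) := B (repr (ival p)) (repr (ival q)).
have b0 p q : b p q = 0.
  apply: (odd_standard_basis_form charF0 std n_odd) => {p q}.
  - move=> a p p' q; rewrite /b -quadZl -quadDl; apply: form_eq => //.
    + by rewrite memvD ?memvZ.
    + exact: preimage_r.
    + by rewrite quotv_pi_linear !quotv_reprK ivalP.
  - by move=> p q; apply: quad_sym.
  move=> A p q; rewrite /b; pose x := vsval (phi A).
  have act m : quotv_pi J (repr (ival (pull_rep (sub_rep u) phi A m))) =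
      quotv_pi J [l x, repr (ival m)].
    rewrite quotv_reprK /ival /= /quot_act /x.
    by rewrite lfunE.
  have xP m : [l x, repr (ival m)] \in factor_preimage.
    by apply/preimageP; exists (pull_rep (sub_rep u) phi A m); rewrite -act quotv_reprK.
  rewrite (form_eq _ (xP p) _ (act p)) ?preimage_r // quad_invN; congr (- _).
  rewrite quad_sym [RHS]quad_sym.
  by rewrite (form_eq _ (xP q) _ (act q)) ?preimage_r.
apply/subvP => y yP; apply/mem_orthovP => z zP.
have /preimageP[p def_p] := yP; have /preimageP[q def_q] := zP.
rewrite (form_eq yP (rep_pre p)) ?preimage_r ?quotv_reprK //.
rewrite quad_sym (form_eq zP (rep_pre q)) ?preimage_r ?quotv_reprK //.
by rewrite quad_sym; apply: b0.
Qed.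

End FactorSubmodule.

Theorem proposition3p1 (F : closedFieldType) (charF0 : [pchar F] =i pred0)
    (g : lieAlgType F) (B : quadForm g) (s : lieSubalg g) (r : lieIdeal g)
    (r_radical : is_radical r) (s_levi : is_levi s r)
    (g_nonsolvable : ~ lie_solvable (fullv : {vspace g}))
    (g_nonsimple : ~ lie_simple g)
    (g_irreducible : irreducible_quadratic B)
    (r_neq_rperp : (r : {vspace g}) <> orth_ideal B r)
    (dim_g : (\dim {:g} <= 13)%N) :
  (exists phi : lieHom (sl F 2) (subvs_of s), bijective phi) /\
  (forall phi : lieHom (sl F 2) (subvs_of s), bijective phi ->
   forall u : submod (factor_rep (orth_ideal B r) s r),
     irreducible_rep (sub_rep u) ->
     exists2 n : nat, n \in [:: 0; 1; 2; 4; 6]%N &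
       rep_iso (pull_rep (sub_rep u) phi) (Vn F n)).
Proof.
have Jr := perp_radical_sub r_radical s_levi g_nonsolvable g_nonsimple g_irreducible.
have [iso dim_s] := levi_sl2 charF0 r_radical s_levi g_nonsolvable g_nonsimple
  g_irreducible r_neq_rperp dim_g.
split=> // phi phi_bij u irr_u.
have [n [v std]] := sl2_irreducible_basis charF0 (pull_rep_irreducible phi_bij irr_u).
exists n; last exact: (sl2_standard_basis_iso charF0 std).
have dim_u : \dim u = n.+1 by case: std => <- *; rewrite dimvf.
have dim_pre := dim_factor_preimage u.
have dim_J : \dim (orth_ideal B r) = 3%N by rewrite -dim_s; exact: dim_perp_radical s_levi.
rewrite dim_u dim_J in dim_pre.
have dim_r : (\dim r + 3)%N = \dim {:g} by rewrite -dim_J addnC dim_orthov.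
have le_r := dimvS (factor_preimage_sub Jr u).
(* The preimage has dimension (n + 1) + 3 and, being totally isotropic, at most half of dim g. *)
have odd_n : odd n -> (n.+4 + n.+4 <= \dim {:g})%N.
  move=> n_odd; have := dimvS (odd_factor_isotropic charF0 Jr n_odd std).
  by have := dim_orthov B (factor_preimage u); rewrite dim_pre; lia.
(* (n + 1) + 3 <= dim r = dim g - 3 <= 10. *)
have n6 : (n <= 6)%N by rewrite dim_pre in le_r; lia.
have {}odd_n : odd n -> (n <= 2)%N by move/odd_n; lia.
by case: n {std dim_u dim_pre} n6 odd_n => [|[|[|[|[|[|[|]]]]]]] // _ /(_ isT).
Qed.
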